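(* Let $\mathcal{D}$ be a non-crossing $x$-monotone drawing of a graph $G$. Then there is a non-crossing straight-line drawing $\mathcal{D}'$ of $G$, equivalent to $\mathcal{D}$, in which every vertex of $G$ has the same $x$-coordinate as in $\mathcal{D}$.
   Context: Graphs are finite and simple. A drawing of a graph $G$ is a representation of its vertices by points of the plane $\mathbb{R}^2$ and of its edges by simple Jordan arcs connecting the corresponding point pairs. The arcs may cross each other, subject to the following assumptions: (1) no edge passes through any vertex other than its endpoints; (2) any two edges cross only a finite number of times; (3) no three edges cross at the same point; (4) if two edges share an interior point $p$, then they properly cross at $p$, i.e., one arc passes from one side of the other arc to the other side; (5) no two vertices have the same $x$-coordinate. A drawing is $x$-monotone if every vertical line intersects every edge in at most one point. A drawing is non-crossing if no two edges cross. A drawing is straight-line if every edge is represented by a straight-line segment. Two $x$-monotone drawings of the same graph $G$ are equivalent if, in a small neighborhood of each vertex $v\in V(G)$, the relationships ''lies above'' and ''lies below'' between the edges incident to $v$ are the same in both drawings. That is, for each vertex $v$, the same edges leave $v$ to the left (resp. to the right) in both drawings, and the vertical order, near $v$, of the edges leaving $v$ to the left (resp. to the right) is the same in both drawings. *)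

(* Defs.v *)
From HB Require Import structures.
From mathcomp Require Import all_boot all_order all_algebra.
From mathcomp Require Import all_classical all_reals all_analysis.

Set Implicit Arguments.
Unset Strict Implicit.
Unset Printing Implicit Defensive.

Import Order.TTheory GRing.Theory Num.Theory.
Import numFieldNormedType.Exports.
Local Open Scope classical_set_scope.
Local Open Scope ring_scope.

Record sgraph := SGraph {
  vertex :> finType;
  edges : {set {set vertex}};
  edges_card2 : forall f, f \in edges -> #|f| = 2%N
}.

Section Plane.
Variable R : realType.
Implicit Types (A B : set (R * R)) (a b p : R * R).

Definition segment a b : set (R * R) :=
  [set ((1 - t) * a.1 + t * b.1, (1 - t) * a.2 + t * b.2) | t in `[0, 1]].

Definition arc_param (c : R -> R * R) A a b : Prop :=
  [/\ {within `[0, 1], continuous c},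
      {in `[0, 1] &, injective c},
      c 0 = a, c 1 = b & c @` `[0, 1] = A].

Definition jordan_arc A a b : Prop := exists c, arc_param c A a b.

(* [phi] is a homeomorphism from the open set [U] onto the plane that carries
   the part of [A] inside [U] onto the horizontal axis.  By the Schoenflies
   theorem such charts exist around every interior point of a Jordan arc; the
   two sides of [A] near a point of [U] are then the preimages of the upper
   and lower open half-planes. *)
Definition flat_chart A (U : set (R * R)) (phi : R * R -> R * R) : Prop :=
  [/\ open U,
      {within U, continuous phi},
      exists psi : R * R -> R * R,
        [/\ continuous psi,
            forall q, U q -> psi (phi q) = q
          & forall z, U (psi z) /\ phi (psi z) = z]
    & forall q, U q -> (A q <-> (phi q).2 = 0)].

(* Fixing the direction (from above to below) loses nothing: the
   parametrization of [B] may be reversed. *)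
Definition passes_across A B p : Prop :=
  exists (U : set (R * R)) (phi : R * R -> R * R) (a b : R * R)
         (c : R -> R * R) (t : R),
    [/\ U p /\ flat_chart A U phi,
        arc_param c B a b,
        0 < t < 1 /\ c t = p,
        \forall s \near t^'-, U (c s) /\ 0 < (phi (c s)).2
      & \forall s \near t^'+, U (c s) /\ (phi (c s)).2 < 0].

Definition properly_cross A B p : Prop :=
  passes_across A B p \/ passes_across B A p.

End Plane.

(* Only the values of [arc] on the edges of [G] are meaningful. *)
Record layout (R : realType) (G : sgraph) := Layout {
  pos : G -> R * R;
  arc : {set G} -> set (R * R)
}.

Section Drawing.
Variables (R : realType) (G : sgraph).
Implicit Types (D : layout R G) (f g h : {set G}) (v : G) (p q : R * R).

Definition arc_interior D f : set (R * R) :=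
  arc D f `\` [set pos D v | v in [set` f]].

Definition cross_at D f g p : Prop :=
  [/\ arc_interior D f p, arc_interior D g p
    & properly_cross (arc D f) (arc D g) p].

Record is_drawing D : Prop := IsDrawing {
  drawing_arc : forall u v, [set u; v]%SET \in edges G ->
    jordan_arc (arc D [set u; v]%SET) (pos D u) (pos D v);
  drawing_vertex : forall f v, f \in edges G -> v \notin f ->
    ~ arc D f (pos D v);
  drawing_finite : forall f g, f \in edges G -> g \in edges G -> f != g ->
    finite_set [set p | cross_at D f g p];
  drawing_triple : forall f g h p,
    f \in edges G -> g \in edges G -> h \in edges G ->
    f != g -> g != h -> f != h ->
    ~ [/\ cross_at D f g p, cross_at D g h p & cross_at D f h p];
  drawing_proper : forall f g p, f \in edges G -> g \in edges G -> f != g ->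
    arc_interior D f p -> arc_interior D g p ->
    properly_cross (arc D f) (arc D g) p;
  drawing_abscissa : injective (fun v => (pos D v).1)
}.

Definition x_monotone D : Prop :=
  forall f, f \in edges G ->
  forall x p q, arc D f p -> arc D f q -> p.1 = x -> q.1 = x -> p = q.

Definition noncrossing D : Prop :=
  forall f g, f \in edges G -> g \in edges G -> f != g ->
  forall p, ~ cross_at D f g p.

Definition straight_line D : Prop :=
  forall u v, [set u; v]%SET \in edges G ->
  arc D [set u; v]%SET = segment (pos D u) (pos D v).

Definition leaves_left D v f : Prop :=
  \forall p \near pos D v, arc D f p -> p <> pos D v -> p.1 < (pos D v).1.

Definition leaves_right D v f : Prop :=
  \forall p \near pos D v, arc D f p -> p <> pos D v -> (pos D v).1 < p.1.

(* Meaningful when [f] and [g] are incident to [v] and leave it on the same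
   side; otherwise vacuously true. *)
Definition lies_above D v f g : Prop :=
  \forall p \near pos D v & q \near pos D v,
    arc D f p -> arc D g q -> p <> pos D v -> q <> pos D v ->
    p.1 = q.1 -> q.2 < p.2.

Definition equivalent D D' : Prop :=
  [/\ x_monotone D, x_monotone D'
    & forall v,
      [/\ forall f, f \in edges G -> v \in f ->
            (leaves_left D v f <-> leaves_left D' v f) /\
            (leaves_right D v f <-> leaves_right D' v f),
          forall f g, f \in edges G -> g \in edges G -> v \in f -> v \in g ->
            leaves_left D v f -> leaves_left D v g ->
            (lies_above D v f g <-> lies_above D' v f g)
        & forall f g, f \in edges G -> g \in edges G -> v \in f -> v \in g ->
            leaves_right D v f -> leaves_right D v g ->
            (lies_above D v f g <-> lies_above D' v f g)]].

End Drawing.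

(* Main.v *)
Require Import Defs.
From mathcomp Require Import all_boot all_order all_algebra.
From mathcomp Require Import all_classical all_reals all_analysis.
From mathcomp Require Import ring lra.

(** In a non-crossing x-monotone drawing every edge is the graph of a continuous
function over the interval between the abscissae of its ends, and two such
graphs keep their vertical order over the whole of their common interval.  All
that has to be preserved is therefore combinatorial: for every vertex [v] and
every edge [e] passing strictly over or under it, the side of [e] on which [v]
lies.  If new ordinates [z] put every vertex on the correct side of the
corresponding chords, then at each end of the common interval of two chords an
end of one of them is compared with the other; as a difference of affine
functions that has the right sign at both ends has it in between, the chords
have the order of the edges ([chord_lt]), so they do not cross and leave each
vertex in the same order.

The conditions on [z] are strict homogeneous linear inequalities.  By Gordan's
theorem ([gordan]) they are solvable unless some nonnegative weights, not all
zero, combine them into the zero functional.  Such weights are a system of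
contact forces between vertices and edges in equilibrium, every edge being a
beam supported at its two ends ([lever_kink_stress]).  The bending moments of
the beams are broken lines: the moment of [e] vanishes outside the interval of
[e], bends down at the vertices above [e] and up at the vertices below [e], and
the moments of all edges add up to zero at every abscissa.

It remains to see that a simple graph carries no such stress ([stress_eq0]).
Let [S t y] be the sum at the abscissa [t] of the moments of the edges passing
below the height [y] ([level_sum]).

- Followed along an edge, [S] is concave ([level_sum_concave]).  At a vertex
  above the edge all relevant summands bend down; at a vertex below it the
  summands left out bend up, and the total is zero.
- Hence [S] is nonnegative ([vertex_sum_ge0]): among the vertices where it is
  minimal take the rightmost one; the lowest edge above it carries the minimum
  on to its right end.
- Hence also, if [S] vanishes somewhere inside an edge, then it vanishes all
  along this edge, including its ends ([zero_along]).
- A vertex on which a force acts has [S > 0], after a reflection if the force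
  comes from an edge below it ([vertex_sum_gt0]).  On the vertical line of such
  a vertex the positive values of [S] around it are enclosed between an edge [e]
  and a higher edge [f] just outside of which [S] vanishes.
  The positive region cannot end before [e] and [f] do
  ([corridor_rend]): the first zero vertex inside it would lie just below an
  edge along which [S] vanishes, and that edge reaches back to an earlier zero
  vertex or to the starting line.  So [e] and [f] have the same right end, by
  reflection also the same left end, and a simple graph has no two such
  edges. *)

Set Implicit Arguments.
Unset Strict Implicit.
Unset Printing Implicit Defensive.

Import Order.TTheory GRing.Theory Num.Theory.
Import numFieldNormedType.Exports.
Import Defs.
Local Open Scope ring_scope.

(** * Gordan's theorem of the alternative *)

Section Gordan.
Variables (R : realFieldType) (V : finType).
Implicit Types (a b u : {ffun V -> R}) (s : seq {ffun V -> R}).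

Definition dotf a (z : V -> R) : R := \sum_v a v * z v.

(** Nonnegative combinations in which at least one weight is positive.  The
inductive form makes the elimination of a variable compositional; weights are
recovered in [positive_combination_weights]. *)
Inductive positive_combination s : {ffun V -> R} -> Prop :=
| PosMem a : a \in s -> positive_combination s a
| PosScale k a : 0 < k -> positive_combination s a ->
    positive_combination s [ffun v => k * a v]
| PosAdd a b : positive_combination s a -> positive_combination s b ->
    positive_combination s [ffun v => a v + b v].

Lemma positive_combination_trans s1 s2 u :
  (forall a, a \in s1 -> positive_combination s2 a) ->
  positive_combination s1 u -> positive_combination s2 u.
Proof.
move=> s12; elim=> [a /s12 //|k a k0 _ IH|a b _ IHa _ IHb].
- exact: PosScale.
- exact: PosAdd.
Qed.

Lemma exists_lt_all (U : seq R) : exists m, forall y, y \in U -> m < y.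
Proof.
elim: U => [|y U [m mU]]; first by exists 0.
exists (Num.min m (y - 1)) => y'; rewrite inE gt_min => /predU1P[->|/mU->//].
by rewrite ltrBlDr ltrDl ltr01 orbT.
Qed.

Lemma exists_between1 (x : R) (U : seq R) : (forall y, y \in U -> x < y) ->
  exists2 m, x < m & forall y, y \in U -> m < y.
Proof.
elim: U => [|y U IH] xU; first by exists (x + 1); rewrite ?ltrDl.
have [|m xm mU] := IH; first by move=> y' y'U; apply: xU; rewrite inE y'U orbT.
have xy : x < y by apply: xU; rewrite mem_head.
exists (Num.min m ((x + y) / 2)); first by rewrite lt_min xm midf_lt.
move=> y'; rewrite inE gt_min => /predU1P[->|/mU->//].
by rewrite (midf_lt xy) orbT.
Qed.

(** The one-variable case of the elimination: finitely many strict lower and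
upper bounds are compatible as soon as they are so pairwise. *)
Lemma exists_between (L U : seq R) :
  (forall x y, x \in L -> y \in U -> x < y) ->
  exists m, (forall x, x \in L -> x < m) /\ (forall y, y \in U -> m < y).
Proof.
case: L => [_|x L LU]; first by have [m] := exists_lt_all U; exists m.
have [M ML LM] : exists2 M, M \in x :: L & forall x', x' \in x :: L -> x' <= M.
  elim: L {LU} x => [|x' L IH] x.
    by exists x; rewrite ?mem_head // => x'; rewrite inE => /eqP->.
  have [M ML LM] := IH x'; have [xM|Mx] := leP x M.
    exists M; first by rewrite inE ML orbT.
    by move=> x''; rewrite inE => /predU1P[->|/LM].
  exists x; rewrite ?mem_head // => x''; rewrite inE => /predU1P[->//|/LM].
  by move=> /le_trans; apply; apply: ltW.
have [|m Mm mU] := @exists_between1 M U; first by move=> y; apply: LU.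
by exists m; split=> // x' /LM /le_lt_trans; apply.
Qed.

Lemma dotf_split a z v : dotf a z = a v * z v + \sum_(w | w != v) a w * z w.
Proof. by rewrite /dotf (bigD1 v). Qed.

(** Fourier-Motzkin elimination: the vectors with a positive and those with a
negative coefficient at [v] bound the value at [v] from below and from above,
and these bounds are compatible exactly when the positive combinations in
which [v] cancels are positive. *)
Lemma gordan_support (vs : seq V) s :
  (forall a w, a \in s -> w \notin vs -> a w = 0) ->
  (exists z, forall a, a \in s -> 0 < dotf a z) \/
  positive_combination s [ffun => 0].
Proof.
elim: vs s => [|v vs IH] s supp.
  case: s supp => [|a s] supp; first by left; exists (fun=> 0).
  right; suff <- : a = [ffun => 0] by apply: PosMem; rewrite mem_head.
  by apply/ffunP => w; rewrite ffunE (supp a) ?mem_head.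
pose mix a b : {ffun V -> R} := [ffun w => - b v * a w + a v * b w].
have mix0 a b : mix a b v = 0 by rewrite ffunE mulNr mulrC addNr.
pose sp := [seq a : {ffun V -> R} <- s | 0 < a v].
pose sn := [seq a : {ffun V -> R} <- s | a v < 0].
pose s0 := [seq a : {ffun V -> R} <- s | a v == 0].
pose s' := s0 ++ [seq mix a b | a <- sp, b <- sn].
have [|[z zpos]|comb] := IH s'.
- move=> a w; rewrite mem_cat mem_filter => /orP[/andP[/eqP av as_] wvs|].
    have [->//|wv] := eqVneq w v; apply: supp as_ _.
    by rewrite inE negb_or wv.
  move=> /allpairsP[[b c] /= []]; rewrite !mem_filter.
  move=> /andP[_ bs] /andP[_ cs] -> wvs; rewrite ffunE.
  have [->|wv] := eqVneq w v; first by rewrite -(mix0 b c) ffunE.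
  by rewrite (supp b w) ?(supp c w) ?inE ?negb_or ?wv // !mulr0 addr0.
(* For the value [m] at [v], the condition of [a] is [a v * m + rest a > 0]. *)
- left; pose rest a := \sum_(w | w != v) a w * z w.
  have [|m [Lm mU]] := @exists_between [seq - rest a / a v | a <- sp]
                                       [seq - rest b / b v | b <- sn].
    move=> _ _ /mapP[a asp ->] /mapP[b bsn ->].
    have: 0 < dotf (mix a b) z.
      by apply: zpos; rewrite mem_cat (allpairs_f mix asp bsn) orbT.
    rewrite (dotf_split _ _ v) mix0 mul0r add0r.
    under eq_bigr do rewrite ffunE mulrDl -!mulrA.
    rewrite big_split -!mulr_sumr -/(rest a) -/(rest b) => mixpos.
    move: asp bsn; rewrite !mem_filter => /andP[av _] /andP[bv _].
    rewrite ltr_pdivrMr // mulrAC ltr_ndivlMr // !mulNr.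
    by rewrite ltrN2 -subr_gt0 addrC mulrC -mulNr (mulrC (rest b)).
  exists (fun w => if w == v then m else z w) => a as_.
  rewrite (dotf_split _ _ v) eqxx (eq_bigr (fun w => a w * z w)); last first.
    by move=> w /negPf ->.
  rewrite -/(rest a); have [av|av|av] := ltgtP (a v) 0.
  + have /mU : - rest a / a v \in [seq - rest b / b v | b <- sn].
      by apply/mapP; exists a => //; rewrite mem_filter av.
    by rewrite ltr_ndivlMr // mulrC -subr_gt0 opprK.
  + have /Lm : - rest a / a v \in [seq - rest b / b v | b <- sp].
      by apply/mapP; exists a => //; rewrite mem_filter av.
    by rewrite ltr_pdivrMr // mulrC -subr_gt0 opprK.
  + rewrite av mul0r add0r.
    have: 0 < dotf a z by apply: zpos; rewrite mem_cat mem_filter av eqxx as_.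
    by rewrite (dotf_split _ _ v) av mul0r add0r.
- right; apply: positive_combination_trans comb => a.
  rewrite mem_cat mem_filter => /orP[/andP[_]|]; first exact: PosMem.
  move=> /allpairsP[[b c] /= []]; rewrite !mem_filter.
  move=> /andP[bv bs] /andP[cv cs] ->.
  have -> : mix b c = [ffun w => [ffun w => - c v * b w] w
                               + [ffun w => b v * c w] w].
    by apply/ffunP => w; rewrite !ffunE.
  by apply: PosAdd; apply: PosScale; rewrite ?oppr_gt0 //; apply: PosMem.
Qed.

Lemma positive_combination_weights (I : finType) (P : pred I)
    (row : I -> {ffun V -> R}) u :
  positive_combination [seq row i | i <- enum P] u ->
  exists c : I -> R, [/\ forall i, 0 <= c i, exists2 i, P i & 0 < c i
    & forall v, u v = \sum_(i | P i) c i * row i v].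
Proof.
elim=> [a /mapP[i]|k a k0 _ [c [c0 [i Pi ci] ac]]
  |a b _ [c [c0 [i Pi ci] ac]] _ [d [d0 _ bd]]].
- rewrite mem_enum => Pi ->; exists (fun j => (j == i)%:R); split=> [j||v].
  + by rewrite ler0n.
  + by exists i => //; rewrite eqxx ltr01.
  + rewrite (bigD1 i) //= eqxx mul1r big1 ?addr0 // => j /andP[_ /negPf->].
    by rewrite mul0r.
- exists (fun j => k * c j); split=> [j||v].
  + by rewrite mulr_ge0 // ltW.
  + by exists i => //; rewrite mulr_gt0.
  + by rewrite ffunE ac mulr_sumr; apply: eq_bigr => j _; rewrite mulrA.
- exists (fun j => c j + d j); split=> [j||v].
  + by rewrite addr_ge0.
  + by exists i => //; rewrite ltr_pwDl.
  + rewrite ffunE ac bd -big_split; apply: eq_bigr => j _ /=.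
    by rewrite mulrDl.
Qed.

(** A positive combination equal to zero excludes a solution; when elimination
of all coordinates finds no solution, it leaves such a combination. *)
Theorem gordan (I : finType) (P : pred I) (row : I -> {ffun V -> R}) :
  (exists z : V -> R, forall i, P i -> 0 < \sum_v row i v * z v) \/
  exists c : I -> R, [/\ forall i, 0 <= c i, exists2 i, P i & 0 < c i
    & forall v, \sum_(i | P i) c i * row i v = 0].
Proof.
have [||comb] := @gordan_support (enum V) [seq row i | i <- enum P].
- by move=> a w _; rewrite mem_enum.
- move=> [z zpos]; left; exists z => i Pi; apply: zpos.
  by rewrite map_f // mem_enum.
- right; have [c [c0 cpos c_eq]] := positive_combination_weights comb.
  by exists c; split=> // v; rewrite -c_eq ffunE.
Qed.

End Gordan.

(** * Broken lines *)

Section BrokenLine.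
Variables (R : realFieldType) (V : finType) (x : V -> R).

(** A kink at [a].  The ramp vanishes to the right of [a], so a combination of
ramps with nodes at the vertices vanishes far to the right, and far to the left
it is affine. *)
Definition ramp (a t : R) : R := Num.max 0 (a - t).

Definition broken_line (k : V -> R) (t : R) : R := \sum_v k v * ramp (x v) t.

Lemma ramp_ge0 a t : 0 <= ramp a t.
Proof. by rewrite le_max lexx. Qed.

Lemma ramp_ge a t : a - t <= ramp a t.
Proof. by rewrite le_max lexx orbT. Qed.

Lemma ramp_id a t : t <= a -> ramp a t = a - t.
Proof. by move=> ta; apply/max_idPr; rewrite subr_ge0. Qed.

Lemma ramp_eq0 a t : a <= t -> ramp a t = 0.
Proof. by move=> ta; apply/max_idPl; rewrite subr_le0. Qed.

Lemma ramp_convex a s t u : s <= t -> t <= u ->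
  (u - s) * ramp a t <= (u - t) * ramp a s + (t - s) * ramp a u.
Proof.
move=> st tu; have ut0 : 0 <= u - t by rewrite subr_ge0.
have ts0 : 0 <= t - s by rewrite subr_ge0.
have [at_|ta] := leP a t.
  by rewrite (ramp_eq0 at_) mulr0 addr_ge0 ?mulr_ge0 ?ramp_ge0.
rewrite (ramp_id (ltW ta)).
have -> : (u - s) * (a - t) = (u - t) * (a - s) + (t - s) * (a - u) by ring.
by rewrite lerD // ler_wpM2l // ramp_ge.
Qed.

Lemma broken_line_comb (k : V -> R) p q s u :
  p * broken_line k s + q * broken_line k u
    = \sum_v k v * (p * ramp (x v) s + q * ramp (x v) u).
Proof.
rewrite !mulr_sumr -big_split /=; apply: eq_bigr => v _.
by rewrite mulrDr !(mulrCA (k v)).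
Qed.

Section Concave.
Variables (k : V -> R) (s t u : R).
Hypotheses (st : s <= t) (tu : t <= u).
Hypothesis k_le0 : forall v, s < x v -> x v < u -> k v <= 0.

(** A ramp with its node outside the interval is affine on it, so only the nodes
inside contribute, with the sign of their coefficient.  The vanishing summand on
the right gives both sides the form required by [broken_line_comb]. *)
Lemma concave_term v :
  k v * ((u - t) * ramp (x v) s + (t - s) * ramp (x v) u)
    <= k v * ((u - s) * ramp (x v) t + 0 * ramp (x v) t).
Proof.
rewrite mul0r addr0; have [xs|sx] := leP (x v) s.
  rewrite !ramp_eq0 ?mulr0 ?addr0 ?mulr0 // (le_trans xs) //.
  exact: le_trans tu.
have [xu|ux] := ltP (x v) u.
  by apply: ler_wnM2l; [exact: k_le0|exact: ramp_convex].
rewrite !ramp_id ?(ltW sx) ?(le_trans tu) //.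
by rewrite le_eqVlt; apply/orP; left; apply/eqP; ring.
Qed.

Lemma broken_line_concave :
  (u - t) * broken_line k s + (t - s) * broken_line k u
    <= (u - s) * broken_line k t.
Proof.
rewrite -[leRHS]addr0 -(mul0r (broken_line k t)) !broken_line_comb.
by apply: ler_sum => v _; apply: concave_term.
Qed.

Lemma broken_line_strictly_concave v : s < t -> t < u -> x v = t -> k v < 0 ->
  (u - t) * broken_line k s + (t - s) * broken_line k u
    < (u - s) * broken_line k t.
Proof.
move=> st' tu' xv kv.
rewrite -[ltRHS]addr0 -(mul0r (broken_line k t)) !broken_line_comb.
rewrite (bigD1 v) // [ltRHS](bigD1 v) //=.
apply: ltr_leD; last by apply: ler_sum => w _; apply: concave_term.
rewrite xv ltr_nM2l // mul0r addr0 (ramp_eq0 (lexx t)) (ramp_eq0 tu) !mulr0.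
by rewrite addr0 (ramp_id st) mulr_gt0 // subr_gt0.
Qed.

End Concave.

Lemma broken_line_sum (I : finType) (P : pred I) (k : I -> V -> R) t :
  \sum_(i | P i) broken_line (k i) t
    = broken_line (fun v => \sum_(i | P i) k i v) t.
Proof.
rewrite exchange_big /=; apply: eq_bigr => v _.
by rewrite mulr_suml.
Qed.

Lemma broken_lineN (k : V -> R) t :
  broken_line (fun v => - k v) t = - broken_line k t.
Proof. by rewrite -sumrN; apply: eq_bigr => v _; rewrite mulNr. Qed.

End BrokenLine.

(** * Diagrams of x-monotone edges *)

Lemma exists_argmin (R : realDomainType) (T : finType) (P : pred T)
    (F : T -> R) i0 : P i0 ->
  exists i, P i /\ forall j, P j -> F i <= F j.
Proof. by move=> Pi0; case: (arg_minP F Pi0) => i Pi Fi; exists i. Qed.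

(** The value of [height d e] matters only between the abscissae of the ends of
[e].  A diagram does not assume continuity: the order conditions below are all
that the argument takes from it. *)
Record diagram (R : realFieldType) (V E : finType) := Diagram {
  absc : V -> R;
  ordi : V -> R;
  lend : E -> V;
  rend : E -> V;
  height : E -> R -> R
}.

Section Diagram.
Variables (R : realFieldType) (V E : finType).
Implicit Types (d : diagram R V E) (e f g : E) (v : V).

Definition spans d e t := absc d (lend d e) < t < absc d (rend d e).

Definition covers d e t := absc d (lend d e) <= t <= absc d (rend d e).

(** [height_neq] and [height_order] together say that the vertical order of two
edges is constant over their common interval, and that they can meet only at an
abscissa where both end.  [lend_rend_inj] is where the graph is simple. *)
Record noncrossing_diagram d : Prop := {
  absc_inj : injective (absc d);
  lend_lt_rend : forall e, absc d (lend d e) < absc d (rend d e);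
  height_lend : forall e, height d e (absc d (lend d e)) = ordi d (lend d e);
  height_rend : forall e, height d e (absc d (rend d e)) = ordi d (rend d e);
  height_off : forall e v, spans d e (absc d v) ->
    height d e (absc d v) != ordi d v;
  height_neq : forall e f t, e != f -> spans d e t -> covers d f t ->
    height d e t != height d f t;
  height_order : forall e f s t,
    covers d e s -> covers d f s -> covers d e t -> covers d f t ->
    height d e s < height d f s -> height d e t <= height d f t;
  lend_rend_inj : forall e f,
    lend d e = lend d f -> rend d e = rend d f -> e = f
}.

(** The two reflections let one-sided statements be proved on one side only.
Reversing the vertical axis exchanges sums over the edges below and above a
point; reversing the horizontal axis exchanges left and right ends. *)
Definition flip_y d : diagram R V E :=
  Diagram (absc d) (fun v => - ordi d v) (lend d) (rend d)
    (fun e t => - height d e t).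

Definition flip_x d : diagram R V E :=
  Diagram (fun v => - absc d v) (ordi d) (rend d) (lend d)
    (fun e t => height d e (- t)).

Lemma spans_flip_x d e t : spans (flip_x d) e t = spans d e (- t).
Proof. by rewrite /spans /= ltrNl ltrNr andbC. Qed.

Lemma covers_flip_x d e t : covers (flip_x d) e t = covers d e (- t).
Proof. by rewrite /covers /= lerNl lerNr andbC. Qed.

Lemma spans_covers d e t : spans d e t -> covers d e t.
Proof. by move=> /andP[lt_ tr]; rewrite /covers !ltW. Qed.

Lemma covers_lend d : noncrossing_diagram d ->
  forall e, covers d e (absc d (lend d e)).
Proof. by move=> nc e; rewrite /covers lexx ltW // lend_lt_rend. Qed.

Lemma covers_rend d : noncrossing_diagram d ->
  forall e, covers d e (absc d (rend d e)).
Proof. by move=> nc e; rewrite /covers lexx ltW // lend_lt_rend. Qed.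

Lemma noncrossing_flip_y d : noncrossing_diagram d ->
  noncrossing_diagram (flip_y d).
Proof.
move=> nc; split=> /=.
- exact: absc_inj nc.
- exact: lend_lt_rend nc.
- by move=> e; rewrite (height_lend nc).
- by move=> e; rewrite (height_rend nc).
- by move=> e v ev; rewrite eqr_opp (height_off nc).
- by move=> e f t ef et ft; rewrite eqr_opp (height_neq nc).
- by move=> e f s t es fs et ft; rewrite ltrN2 lerN2; apply: (height_order nc).
- exact: lend_rend_inj nc.
Qed.

Lemma noncrossing_flip_x d : noncrossing_diagram d ->
  noncrossing_diagram (flip_x d).
Proof.
move=> nc; split=> /=.
- by move=> v w /oppr_inj /(absc_inj nc).
- by move=> e; rewrite ltrN2 (lend_lt_rend nc).
- by move=> e; rewrite opprK (height_rend nc).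
- by move=> e; rewrite opprK (height_lend nc).
- by move=> e v; rewrite spans_flip_x opprK; apply: (height_off nc).
- move=> e f t ef; rewrite spans_flip_x covers_flip_x.
  by apply: (height_neq nc).
- by move=> e f s t; rewrite !covers_flip_x; apply: (height_order nc).
- by move=> e f er el; apply: (lend_rend_inj nc).
Qed.

Lemma covers_spans d : noncrossing_diagram d -> forall e v,
  covers d e (absc d v) -> ~~ spans d e (absc d v) ->
  v = lend d e \/ v = rend d e.
Proof.
move=> nc e v /andP[]; rewrite le_eqVlt => /predU1P[/(absc_inj nc)->|lv].
  by left.
rewrite le_eqVlt => /predU1P[/(absc_inj nc)->|vr]; first by right.
by rewrite /spans lv vr.
Qed.

Lemma height_end d : noncrossing_diagram d -> forall e v,
  covers d e (absc d v) -> ~~ spans d e (absc d v) ->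
  height d e (absc d v) = ordi d v.
Proof.
move=> nc e v ev /(covers_spans nc ev)[]->; first exact: height_lend.
exact: height_rend.
Qed.

Lemma height_lt d : noncrossing_diagram d -> forall e f s t,
  covers d e s -> covers d f s -> covers d e t -> covers d f t ->
  spans d e t || spans d f t ->
  height d e s < height d f s -> height d e t < height d f t.
Proof.
move=> nc e f s t es fs et ft sp lt_s.
have ef : e != f by apply: contraTneq lt_s => ->; rewrite ltxx.
rewrite lt_neqAle (height_order nc es fs et ft lt_s) andbT.
case/orP: sp => sp; first exact: (height_neq nc).
by rewrite eq_sym (height_neq nc) // eq_sym.
Qed.

Definition overlap_l d e f := Num.max (absc d (lend d e)) (absc d (lend d f)).
Definition overlap_r d e f := Num.min (absc d (rend d e)) (absc d (rend d f)).
Definition overlap_mid d e f := (overlap_l d e f + overlap_r d e f) / 2.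

Lemma overlap_lt d : noncrossing_diagram d -> forall e f t,
  covers d e t -> covers d f t -> spans d e t || spans d f t ->
  overlap_l d e f < overlap_r d e f.
Proof.
move=> nc e f t /andP[et te] /andP[ft tf] sp.
rewrite gt_max !lt_min !(lend_lt_rend nc) /= andbT.
case/orP: sp => /andP[lt_ tr].
  by rewrite (lt_le_trans lt_) // (le_lt_trans ft).
by rewrite (le_lt_trans et) // (lt_le_trans lt_).
Qed.

Lemma spans_overlap d e f t :
  overlap_l d e f < t < overlap_r d e f = spans d e t && spans d f t.
Proof. by rewrite gt_max lt_min /spans andbACA. Qed.

Lemma spans_overlap_mid d e f : overlap_l d e f < overlap_r d e f ->
  spans d e (overlap_mid d e f) && spans d f (overlap_mid d e f).
Proof. by move=> lt_lr; rewrite -spans_overlap !midf_lt. Qed.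

(** The order over the common interval, read off at its midpoint; any other
abscissa gives the same answer by [lowerE]. *)
Definition lower d e f :=
  (overlap_l d e f < overlap_r d e f) &&
  (height d e (overlap_mid d e f) < height d f (overlap_mid d e f)).

Lemma lowerE d : noncrossing_diagram d -> forall e f t,
  covers d e t -> covers d f t -> spans d e t || spans d f t ->
  lower d e f = (height d e t < height d f t).
Proof.
move=> nc e f t et ft sp; have lr := overlap_lt nc et ft sp.
have /andP[em fm] := spans_overlap_mid lr.
rewrite /lower lr; apply/idP/idP.
  exact: (height_lt nc (spans_covers em) (spans_covers fm)).
by apply: (height_lt nc et ft); rewrite ?spans_covers ?em.
Qed.

Lemma lowest_above d t y e0 : spans d e0 t -> y <= height d e0 t ->
  exists g, [/\ spans d g t, y <= height d g t
    & forall f, spans d f t -> y <= height d f t ->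
        height d g t <= height d f t].
Proof.
move=> e0t ye0.
have /= [|g [/andP[gt_ yg] gmin]] := @exists_argmin _ _
    [pred g | spans d g t && (y <= height d g t)] (fun g => height d g t) e0.
  by rewrite e0t ye0.
by exists g; split=> // f ft yf; apply: gmin; rewrite /= ft yf.
Qed.

End Diagram.

(** * Sums over the edges below a point *)

Section LevelSum.
Variables (R : realFieldType) (V E : finType) (d : diagram R V E).
Variable M : E -> R -> R.

Local Notation x := (absc d).
Local Notation y := (ordi d).
Local Notation h := (height d).

(** Edges that do not pass over [t] need not be excluded: in all uses their
summand [M g t] is zero. *)
Definition level_sum t z := \sum_(g | h g t < z) M g t.

(** On the line of abscissa [t], the sums are nonzero from just above [e] up to
[f], and vanish just below [e]. *)
Definition corridor t e f :=
  [/\ spans d e t, spans d f t, h e t < h f t, level_sum t (h e t) = 0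
    & forall z, h e t < z -> z <= h f t -> level_sum t z != 0].

Hypothesis nc : noncrossing_diagram d.
Hypothesis offM : forall e t, ~~ spans d e t -> M e t = 0.

Lemma eq_level_sum t z z' :
  (forall g, spans d g t -> (h g t < z) = (h g t < z')) ->
  level_sum t z = level_sum t z'.
Proof.
move=> zz'; rewrite /level_sum big_mkcond [RHS]big_mkcond /=.
apply: eq_bigr => g _; have [/zz'->//|/offM->] := boolP (spans d g t).
by rewrite !if_same.
Qed.

(** No edge separates [z] from the lowest edge above it. *)
Lemma level_sum_lowest t z g : spans d g t -> z <= h g t ->
  (forall f, spans d f t -> z <= h f t -> h g t <= h f t) ->
  level_sum t (h g t) = level_sum t z.
Proof.
move=> gt_ zg gmin; apply: eq_level_sum => f ft; apply/idP/idP.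
  by apply: contraTT; rewrite -!leNgt => /gmin; apply.
by move=> /lt_le_trans; apply.
Qed.

(** Below the lowest edge the sum is empty, hence zero, so going down from [z]
one must cross an edge under which it vanishes; [e] is the first such edge. *)
Lemma level_sum_floor t z : level_sum t z != 0 ->
  exists e, [/\ spans d e t, h e t < z, level_sum t (h e t) = 0
    & forall z', h e t < z' -> z' <= z -> level_sum t z' != 0].
Proof.
move=> Sz.
have [e0 /andP[e0t e0z]] : exists e, spans d e t && (h e t < z).
  apply/existsP; apply: contraNT Sz => /existsPn P0; apply/eqP.
  apply: big1 => g gz; apply: offM.
  by have := P0 g; rewrite gz andbT.
pose P := [pred e | [&& spans d e t, h e t < z & level_sum t (h e t) == 0]].
have [e1 [/andP[e1t e1z] e1min]] := @exists_argmin _ _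
  [pred e | spans d e t && (h e t < z)] (fun e => h e t) e0
  (introT andP (conj e0t e0z)).
(* Nothing lies below the lowest edge [e1]. *)
have Pe1 : P e1.
  rewrite /= e1t e1z /=; apply/eqP/big1 => g ge1; apply: offM.
  apply: contraTN ge1 => gt_; rewrite -leNgt; have [gz|zg] := ltP (h g t) z.
    by apply: e1min; rewrite /= gt_ gz.
  by rewrite (le_trans (ltW e1z)).
have [e [/and3P[et ez /eqP Se] emax]] := exists_argmin (fun e => - h e t) Pe1.
exists e; split=> // z' ez' z'z; apply: contraNneq Sz => Sz'.
have [f /andP[ft z'f]|none] := pickP [pred f | spans d f t && (z' <= h f t)];
    last first.
  rewrite -Sz'; apply/eqP/eq_level_sum => g gt_; apply/idP/idP => [_|].
    by have := none g; rewrite /= gt_ /= ltNge => ->.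
  by move=> /lt_le_trans; apply.
have [g [gt_ z'g gmin]] := lowest_above ft z'f.
have Sg := level_sum_lowest gt_ z'g gmin.
have [gz|zg] := ltP (h g t) z.
  suff: - h e t <= - h g t by rewrite lerN2 leNgt (lt_le_trans ez').
  by apply: emax; rewrite /= gt_ gz Sg Sz' eqxx.
apply/eqP; rewrite -Sz' -Sg; apply: eq_level_sum => k kt.
apply/idP/idP; first by move=> /lt_le_trans; apply.
by apply: contraTT; rewrite -!leNgt => zk; rewrite gmin // (le_trans z'z).
Qed.

Hypothesis zero_along : forall g s t, spans d g s -> covers d g t ->
  level_sum s (h g s) = 0 -> level_sum t (h g t) = 0.

(** Suppose that [e] ends before [f].  Its right end is a zero vertex in the
corridor.  The leftmost zero vertex [q] in the corridor lies just below an edge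
[g], along which the sums then vanish.  If [g] starts to the right of [t], its
left end is a zero vertex further to the left; otherwise [g] crosses the line of
abscissa [t] inside the corridor, where the sums are nonzero. *)
Lemma corridor_rend t e f : corridor t e f ->
  x (rend d f) <= x (rend d e).
Proof.
move=> [et ft ef Se Spos]; rewrite leNgt; apply/negP => re_rf.
have inside s : t < s -> s <= x (rend d e) ->
    [/\ covers d e s, spans d f s & h e s < h f s].
  move=> ts se; have es : covers d e s.
    by move/andP: et => [le_ _]; rewrite /covers se (ltW (lt_trans le_ ts)).
  have fs : spans d f s.
    move/andP: ft => [lf _].
    by rewrite /spans (lt_trans lf ts) (le_lt_trans se).
  split=> //.
  apply: (height_lt nc (spans_covers et) (spans_covers ft) es) => //.
    exact: spans_covers.
  by rewrite fs orbT.
pose Q := [pred q : V | [&& t < x q, x q <= x (rend d e), h e (x q) <= y q,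
                            y q < h f (x q) & level_sum (x q) (y q) == 0]].
have Qr : Q (rend d e).
  have tr : t < x (rend d e) by move/andP: et => [].
  have [_ _ hef] := inside _ tr (lexx _).
  rewrite /= tr lexx -(height_rend nc) lexx hef.
  by rewrite (zero_along et) ?(covers_rend nc) //= eqxx.
(* The leftmost zero vertex of the corridor. *)
have [q [/and5P[tq qr eq qf /eqP Sq] qmin]] := exists_argmin x Qr.
have [eq_cov fq_sp _] := inside _ tq qr.
have [g [gq qg gmin]] := lowest_above fq_sp (ltW qf).
(* [g] is the lowest edge above [q]. *)
have {}qg : y q < h g (x q) by rewrite lt_neqAle eq_sym (height_off nc gq) qg.
have Sg : level_sum (x q) (h g (x q)) = 0.
  by rewrite (level_sum_lowest gq (ltW qg)).
have gf := gmin f fq_sp (ltW qf).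
have eg : h e (x q) < h g (x q) by apply: le_lt_trans qg.
have [glt|tgl] := leP (x (lend d g)) t.
  have gt_ : covers d g t.
    by move/andP: gq => [_ /ltW qrg]; rewrite /covers glt (le_trans (ltW tq)).
  have egt : h e t < h g t.
    by apply: (height_lt nc eq_cov (spans_covers gq) (spans_covers et) gt_);
      rewrite ?et.
  suff gft : h g t <= h f t.
    by have := Spos (h g t) egt gft; rewrite (zero_along gq) ?eqxx.
  have [->//|gf'] := eqVneq g f.
  apply: (height_order nc (spans_covers gq) (spans_covers fq_sp) gt_).
    exact: spans_covers.
  by rewrite lt_neqAle gf (height_neq nc) // spans_covers.
have glq : x (lend d g) < x q by move/andP: gq => [].
have gl_re : x (lend d g) < x (rend d e) by apply: lt_le_trans glq qr.
have [egl fgl _] := inside _ tgl (ltW gl_re).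
have ggl := covers_lend nc g.
suff: x q <= x (lend d g) by rewrite leNgt glq.
apply: qmin; rewrite /= tgl (ltW gl_re) -(height_lend nc) (zero_along gq) //.
rewrite eqxx andbT.
rewrite (height_order nc eq_cov (spans_covers gq)) //=.
apply: (height_lt nc (spans_covers gq) (spans_covers fq_sp) ggl
         (spans_covers fgl)); rewrite ?fgl ?orbT //.
rewrite lt_neqAle gf andbT.
apply: (height_neq nc) => //; last exact: spans_covers.
by apply: contraTneq tgl => ->; rewrite -leNgt; move/andP: ft => [/ltW].
Qed.

End LevelSum.

(** * A noncrossing diagram carries no stress *)

Section Flip.
Variables (R : realFieldType) (V E : finType) (d : diagram R V E).
Implicit Types (M : E -> R -> R).

Lemma level_sum_flip_y2 M t z :
  level_sum (flip_y (flip_y d)) M t z = level_sum d M t z.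
Proof. by apply: eq_bigl => g /=; rewrite opprK. Qed.

(** As the total is zero, minus the sum over the edges above [z] is the sum over
the others. *)
Lemma level_sum_flip_y M M' t z :
  (forall g, M' g t = - M g t) -> \sum_g M g t = 0 ->
  level_sum (flip_y d) M' t (- z) = \sum_(g | height d g t <= z) M g t.
Proof.
move=> M'M tot; rewrite /level_sum (eq_bigr (fun g => - M g t)) // sumrN.
apply/esym/eqP; rewrite -addr_eq0 -[X in _ == X]tot.
rewrite [X in _ == X](bigID (fun g => height d g t <= z)) /=; apply/eqP.
by congr (_ + _); apply: eq_bigl => g; rewrite ltrN2 ltNge.
Qed.

(** A level and its mirror image count the same edges when no edge lies strictly
between them; so below [z] there is a level, not below [z0], whose mirror image
gives the same sum. *)
Lemma level_sum_mirror M M' t z0 z :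
  (forall g t, ~~ spans d g t -> M g t = 0) ->
  (forall g, M' g t = - M g t) -> \sum_g M g t = 0 -> z0 < z ->
  exists z', [/\ - z < z', z' <= - z0
    & level_sum d M t z = level_sum (flip_y d) M' t z'].
Proof.
move=> offM M'M tot z0z.
have [w [z0w wz wmax]] : exists w, [/\ z0 <= w, w < z
    & forall g, spans d g t -> height d g t < z -> height d g t <= w].
  pose P := [pred g | [&& spans d g t, height d g t < z & z0 <= height d g t]].
  have [g0 Pg0|none] := pickP P; last first.
    exists z0; split=> // g gt_ gz; rewrite leNgt; apply/negP => z0g.
    by have := none g; rewrite /= gt_ gz ltW.
  have [g [/and3P[gt_ gz z0g] gmax]] :=
    exists_argmin (fun g => - height d g t) Pg0.
  exists (height d g t); split=> // f ft fz.
  have [z0f|fz0] := leP z0 (height d f t); last exact: le_trans (ltW fz0) z0g.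
  by rewrite -lerN2 gmax //= ft fz z0f.
exists (- w); rewrite ltrN2 lerN2; split=> //.
rewrite (level_sum_flip_y _ M'M tot) /level_sum.
rewrite big_mkcond [RHS]big_mkcond /=; apply: eq_bigr => g _.
have [gt_|/offM->] := boolP (spans d g t); last by rewrite !if_same.
suff -> : (height d g t < z) = (height d g t <= w) by [].
by apply/idP/idP => [|/le_lt_trans]; [exact: wmax|exact].
Qed.

End Flip.

(** The floor of the corridor is found below [z] directly, its ceiling as a
floor in the mirror image. *)
Lemma corridor_exists (R : realFieldType) (V E : finType)
    (d : diagram R V E) M M' t z :
  (forall g t, ~~ spans d g t -> M g t = 0) ->
  (forall g t, M' g t = - M g t) -> \sum_g M g t = 0 ->
  level_sum d M t z != 0 -> level_sum (flip_y d) M' t (- z) != 0 ->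
  exists e f, corridor d M t e f /\ corridor (flip_y d) M' t f e.
Proof.
move=> offM M'M tot Sz Sz'.
have offM' g s : ~~ spans (flip_y d) g s -> M' g s = 0.
  by move=> /offM gs; rewrite M'M gs oppr0.
have tot' : \sum_g M' g t = 0.
  by rewrite (eq_bigr (fun g => - M g t)) // sumrN tot oppr0.
have [e [et ez Se epos]] := level_sum_floor offM Sz.
have [f [ft fz Sf fpos]] := level_sum_floor offM' Sz'.
have zf : z < height d f t by move: fz; rewrite /= ltrN2.
exists e, f; split; split=> //=; rewrite ?ltrN2 ?(lt_trans ez) //.
- move=> w ew wf; have [wz|zw] := leP w z; first exact: epos.
  have [w' [ww' w'z ->]] := level_sum_mirror offM (fun g => M'M g t) tot zw.
  by apply: fpos => //; apply: le_lt_trans ww'; rewrite lerN2.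
- move=> w fw we; have [wz|zw] := leP w (- z); first exact: fpos.
  have MM' g : M g t = - M' g t by rewrite M'M opprK.
  have [w' [ww' w'z ->]] := level_sum_mirror offM' MM' tot' zw.
  rewrite level_sum_flip_y2; rewrite opprK in w'z.
  by apply: epos => //; apply: le_lt_trans ww'; rewrite lerNr.
Qed.

Section Stress.
Variables (R : realFieldType) (V E : finType).

(** The bending moment of the edge [g]; [k g v] is its change of slope
at [v]. *)
Definition moment (d : diagram R V E) (k : E -> V -> R) (g : E) : R -> R :=
  broken_line (absc d) (k g).

(** A force between [v] and [g] can only push them apart, whence the signs of
[stress_above] and [stress_below]; [stress_total] is the equilibrium of every
vertex and [moment_off] that of every edge.  At the ends of [g] the sign of
[k g] is free. *)
Record stress (d : diagram R V E) (k : E -> V -> R) : Prop := {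
  stress_above : forall g v, spans d g (absc d v) ->
    height d g (absc d v) < ordi d v -> k g v <= 0;
  stress_below : forall g v, spans d g (absc d v) ->
    ordi d v < height d g (absc d v) -> 0 <= k g v;
  stress_off : forall g v, ~~ covers d g (absc d v) -> k g v = 0;
  stress_total : forall v, \sum_g k g v = 0;
  moment_off : forall g t, ~~ spans d g t -> moment d k g t = 0
}.

Lemma moment_total d k t : stress d k -> \sum_g moment d k g t = 0.
Proof.
move=> st; rewrite broken_line_sum; apply: big1 => v _.
by rewrite (stress_total st) mul0r.
Qed.

Lemma stress_flip_y d k : stress d k -> stress (flip_y d) (fun g v => - k g v).
Proof.
move=> st; split=> /=.
- by move=> g v gv; rewrite ltrN2 oppr_le0; apply: (stress_below st).
- by move=> g v gv; rewrite ltrN2 oppr_ge0; apply: (stress_above st).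
- by move=> g v /(stress_off st) ->; rewrite oppr0.
- by move=> v; rewrite sumrN (stress_total st) oppr0.
- by move=> g t gt_; rewrite /moment broken_lineN -/(moment d k g t)
    (moment_off st) ?oppr0.
Qed.

Variables (d : diagram R V E) (k : E -> V -> R).
Hypotheses (nc : noncrossing_diagram d) (st : stress d k).

Local Notation x := (absc d).
Local Notation y := (ordi d).
Local Notation h := (height d).
Local Notation S := (level_sum d (moment d k)).

(** The change of slope at [v] of the broken line that [level_sum] follows along
[e], see [level_sum_along]. *)
Definition lower_kink e v := \sum_(g | lower d g e) k g v.

(** An edge that ends at [v] is above [e] there, so every edge below [e] that
contributes at [v] passes below [v]. *)
Lemma lower_kink_above e v : spans d e (x v) -> h e (x v) < y v ->
  lower_kink e v <= 0.
Proof.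
move=> ev hey; apply: sumr_le0 => g ge.
have [gv|/(stress_off st)->//] := boolP (covers d g (x v)).
rewrite (lowerE nc gv (spans_covers ev)) ?ev ?orbT // in ge.
have [sp|/(height_end nc gv) hgy] := boolP (spans d g (x v)).
  exact: (stress_above st sp (lt_trans ge hey)).
by move: ge; rewrite hgy ltNge (ltW hey).
Qed.

(** Here the edges below [e] may end at [v] and contribute with any sign, but
those not below [e] cannot, and the total over all edges is zero. *)
Lemma lower_kink_below e v : spans d e (x v) -> y v < h e (x v) ->
  lower_kink e v = - (\sum_(g | ~~ lower d g e) k g v) /\
  forall g, ~~ lower d g e -> 0 <= k g v.
Proof.
move=> ev yhe; split.
  apply/eqP; rewrite -addr_eq0 -[X in _ == X](stress_total st v).
  rewrite [eqbRHS](bigID (fun g => lower d g e)) /=; exact: eqxx.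
move=> g ge.
have [gv|/(stress_off st)->//] := boolP (covers d g (x v)).
rewrite (lowerE nc gv (spans_covers ev)) ?ev ?orbT // -leNgt in ge.
have [sp|/(height_end nc gv) hgy] := boolP (spans d g (x v)).
  exact: (stress_below st sp (lt_le_trans yhe ge)).
by move: ge; rewrite hgy leNgt yhe.
Qed.

Lemma lower_kink_le0 e v : spans d e (x v) -> lower_kink e v <= 0.
Proof.
move=> ev; have := height_off nc ev; rewrite neq_lt => /orP[hey|yhe].
  exact: lower_kink_above.
have [-> kge] := lower_kink_below ev yhe.
by rewrite oppr_le0 sumr_ge0.
Qed.

(** The strict case: a force pushing [g] away from [v], with [e] between them or
equal to [g]. *)
Lemma lower_kink_lt0 e g v : spans d e (x v) -> y v < h e (x v) ->
  spans d g (x v) -> h e (x v) <= h g (x v) -> 0 < k g v ->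
  lower_kink e v < 0.
Proof.
move=> ev yhe gv eg kg; have [-> kge] := lower_kink_below ev yhe.
have ge : ~~ lower d g e.
  by rewrite (lowerE nc (spans_covers gv) (spans_covers ev)) ?gv // -leNgt.
rewrite oppr_lt0 (bigD1 g) //= ltr_pwDl // sumr_ge0 // => f /andP[fe _].
exact: kge.
Qed.

(** The set of edges below [e] does not depend on [t], which turns the sum into
a single broken line on the interval of [e]. *)
Lemma level_sum_along e t : covers d e t ->
  S t (h e t) = broken_line x (lower_kink e) t.
Proof.
move=> et; rewrite -broken_line_sum /level_sum big_mkcond [RHS]big_mkcond.
apply: eq_bigr => g _ /=; rewrite -/(moment d k g t).
have [gt_|/(moment_off st)->] := boolP (spans d g t); last by rewrite !if_same.
by rewrite (lowerE nc (spans_covers gt_) et) ?gt_.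
Qed.

Lemma spans_between e s t u : covers d e s -> covers d e u ->
  s < t -> t < u -> spans d e t.
Proof.
move=> /andP[ls _] /andP[_ ur] st_ tu.
by rewrite /spans (le_lt_trans ls) // (lt_le_trans tu).
Qed.

Lemma level_sum_concave e s t u : covers d e s -> covers d e u ->
  s <= t -> t <= u ->
  (u - t) * S s (h e s) + (t - s) * S u (h e u) <= (u - s) * S t (h e t).
Proof.
move=> es eu st_ tu; have et : covers d e t.
  move/andP: es => [ls _]; move/andP: eu => [_ ur].
  by rewrite /covers (le_trans ls) // (le_trans tu).
rewrite !level_sum_along //; apply: broken_line_concave => // v sv vu.
exact/lower_kink_le0/(spans_between es eu).
Qed.

Definition vertex_sum v := S (x v) (y v).

Lemma vertex_sum_lend e :
  S (x (lend d e)) (h e (x (lend d e))) = vertex_sum (lend d e).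
Proof. by rewrite (height_lend nc). Qed.

Lemma vertex_sum_rend e :
  S (x (rend d e)) (h e (x (rend d e))) = vertex_sum (rend d e).
Proof. by rewrite (height_rend nc). Qed.

(** With no edge above [v], the sum at [v] would be over all edges, hence
zero. *)
Lemma edge_above v : vertex_sum v != 0 ->
  exists g, [/\ spans d g (x v), y v < h g (x v)
    & S (x v) (h g (x v)) = vertex_sum v].
Proof.
move=> Sv.
have [e0 /andP[e0v /ltW ve0]] : exists e, spans d e (x v) && (y v < h e (x v)).
  apply/existsP; apply: contraNT Sv => /existsPn P0; apply/eqP.
  rewrite -(moment_total (x v) st) /vertex_sum /level_sum big_mkcond /=.
  apply: eq_bigr => g _.
  have [gv|/(moment_off st)->] := boolP (spans d g (x v)).
    have := P0 g; rewrite gv /= -leNgt => gy.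
    by rewrite lt_neqAle (height_off nc gv) gy.
  by rewrite if_same.
have [g [gv vg gmin]] := lowest_above e0v ve0.
exists g; split=> //.
- by rewrite lt_neqAle eq_sym (height_off nc gv).
- exact: (level_sum_lowest (moment_off st)).
Qed.

(** A minimum principle.  A negative minimum at a vertex is attained inside the
edge just above it, and then, by concavity, also at the right end of that edge:
impossible for the rightmost minimal vertex. *)
Lemma vertex_sum_ge0 v : 0 <= vertex_sum v.
Proof.
rewrite leNgt; apply/negP => Sv.
(* [w0] minimizes the sum, and [w] is the rightmost such vertex. *)
have [w0 [_ w0min]] := @exists_argmin _ _ predT vertex_sum v isT.
have [w [/eqP Sw wmax]] := @exists_argmin _ _
  [pred w | vertex_sum w == vertex_sum w0] (fun w => - x w) w0 (eqxx _).
have Sw0 : vertex_sum w < 0 by rewrite Sw (le_lt_trans _ Sv) // w0min.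
have [|g [gw _ Sg]] := @edge_above w; first by rewrite lt_eqF.
have /andP[lw wr] := gw.
suff /wmax : vertex_sum (rend d g) == vertex_sum w0 by rewrite lerN2 leNgt wr.
rewrite eq_le w0min // andbT -Sw.
have := level_sum_concave (covers_lend nc g) (covers_rend nc g)
  (ltW lw) (ltW wr).
rewrite vertex_sum_lend vertex_sum_rend Sg => conc.
rewrite -(@ler_pM2l _ (x w - x (lend d g))) ?subr_gt0 //.
have Slw : (x (rend d g) - x w) * vertex_sum w <=
           (x (rend d g) - x w) * vertex_sum (lend d g).
  by rewrite ler_pM2l ?subr_gt0 // Sw w0min.
move: conc Slw; lra.
Qed.

Lemma vertex_sums_zero e t : spans d e t -> S t (h e t) = 0 ->
  vertex_sum (lend d e) = 0 /\ vertex_sum (rend d e) = 0.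
Proof.
move=> et Se; have /andP[lt_ tr] := et.
have := level_sum_concave (covers_lend nc e) (covers_rend nc e)
  (ltW lt_) (ltW tr).
rewrite vertex_sum_lend vertex_sum_rend Se mulr0.
have pl : 0 <= (x (rend d e) - t) * vertex_sum (lend d e).
  by rewrite mulr_ge0 ?vertex_sum_ge0 // subr_ge0 ltW.
have pr : 0 <= (t - x (lend d e)) * vertex_sum (rend d e).
  by rewrite mulr_ge0 ?vertex_sum_ge0 // subr_ge0 ltW.
rewrite le_eqVlt ltNge addr_ge0 // orbF paddr_eq0 // !mulf_eq0 !subr_eq0.
by rewrite (gt_eqF tr) (gt_eqF lt_) /= => /andP[/eqP-> /eqP->].
Qed.

Lemma level_sum_ge0 e t : covers d e t -> 0 <= S t (h e t).
Proof.
move=> /andP[lt_ tr].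
have := level_sum_concave (covers_lend nc e) (covers_rend nc e) lt_ tr.
rewrite vertex_sum_lend vertex_sum_rend => conc.
have lr : 0 < x (rend d e) - x (lend d e) by rewrite subr_gt0 (lend_lt_rend nc).
rewrite -(pmulr_rge0 _ lr).
by apply: le_trans conc; rewrite addr_ge0 // mulr_ge0 ?vertex_sum_ge0 ?subr_ge0.
Qed.

(** A nonnegative concave function that vanishes inside an interval is zero on
it. *)
Lemma zero_along e s t : spans d e s -> covers d e t ->
  S s (h e s) = 0 -> S t (h e t) = 0.
Proof.
move=> es et Se; have [Sl Sr] := vertex_sums_zero es Se.
apply/eqP; rewrite eq_le level_sum_ge0 // andbT.
have /andP[ls sr] := es; have /andP[lt_ tr] := et.
have [ts|st_|->] := ltgtP t s; last by rewrite Se.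
- have := level_sum_concave et (covers_rend nc e) (ltW ts) (ltW sr).
  by rewrite vertex_sum_rend Sr Se !mulr0 addr0 pmulr_rle0 // subr_gt0.
- have := level_sum_concave (covers_lend nc e) et (ltW ls) (ltW st_).
  by rewrite vertex_sum_lend Sl Se !mulr0 add0r pmulr_rle0 // subr_gt0.
Qed.

(** Strict concavity at [v] of the sum along the lowest edge above [v], whose
values at the ends are nonnegative. *)
Lemma vertex_sum_gt0 g v : spans d g (x v) -> y v < h g (x v) -> 0 < k g v ->
  0 < vertex_sum v.
Proof.
move=> gv vg kg.
have [e [ev ve Se emin]] : exists e, [/\ spans d e (x v), y v < h e (x v),
    S (x v) (h e (x v)) = vertex_sum v & h e (x v) <= h g (x v)].
  have [e [ev ve emin]] := lowest_above gv (ltW vg).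
  exists e; split=> //; last exact: emin (ltW vg).
    by rewrite lt_neqAle eq_sym (height_off nc ev).
  exact: (level_sum_lowest (moment_off st)).
have /andP[lv vr] := ev.
have neg := lower_kink_lt0 ev ve gv emin kg.
have lower_le0 w : x (lend d e) < x w -> x w < x (rend d e) ->
    lower_kink e w <= 0.
  by move=> lw wr; apply: lower_kink_le0; rewrite /spans lw.
have := broken_line_strictly_concave (ltW lv) (ltW vr) lower_le0
  lv vr erefl neg.
rewrite -!level_sum_along ?covers_lend ?covers_rend ?spans_covers //.
rewrite vertex_sum_lend vertex_sum_rend Se => conc.
have lr : 0 < x (rend d e) - x (lend d e) by rewrite subr_gt0 (lend_lt_rend nc).
rewrite -(pmulr_rgt0 _ lr).
apply: le_lt_trans conc.
by rewrite addr_ge0 // mulr_ge0 ?vertex_sum_ge0 // subr_ge0 ltW.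
Qed.

End Stress.

Lemma corridor_flip_x (R : realFieldType) (V E : finType)
    (d : diagram R V E) M t e f : corridor d M t e f ->
  corridor (flip_x d) (fun g s => M g (- s)) (- t) e f.
Proof.
by move=> [et ft ef Se Spos]; split; rewrite ?spans_flip_x /level_sum /= ?opprK.
Qed.

Lemma corridor_ends (R : realFieldType) (V E : finType)
    (d : diagram R V E) k t e f :
  noncrossing_diagram d -> stress d k -> corridor d (moment d k) t e f ->
  absc d (rend d f) <= absc d (rend d e) /\
  absc d (lend d e) <= absc d (lend d f).
Proof.
move=> nc st cor; split.
  exact: (corridor_rend nc (moment_off st) (zero_along nc st) cor).
rewrite -lerN2.
apply: (corridor_rend (noncrossing_flip_x nc) _ _ (corridor_flip_x cor)).
  by move=> g s; rewrite spans_flip_x; apply: (moment_off st).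
move=> g s u; rewrite spans_flip_x covers_flip_x.
exact: (zero_along nc st).
Qed.

(** A positive force at [v] makes the sum at [v] positive.  The corridor around
[v], seen in the four reflections of the diagram, forces its two sides to have
the same left and the same right end. *)
Lemma stress_le0 (R : realFieldType) (V E : finType)
    (d : diagram R V E) k g v :
  noncrossing_diagram d -> stress d k -> spans d g (absc d v) ->
  ordi d v < height d g (absc d v) -> k g v <= 0.
Proof.
move=> nc st gv vg; rewrite leNgt; apply/negP => kg.
have nc' := noncrossing_flip_y nc; have st' := stress_flip_y st.
have Sv := vertex_sum_gt0 nc st gv vg kg.
pose M := moment d k; pose M' := moment (flip_y d) (fun g v => - k g v).
have M'M f t : M' f t = - M f t by rewrite /M' /moment broken_lineN.
have tot := moment_total (absc d v) st.
have Sv' : level_sum (flip_y d) M' (absc d v) (- ordi d v) != 0.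
  rewrite (level_sum_flip_y _ _ (fun g => M'M g _) tot).
  suff -> : \sum_(f | height d f (absc d v) <= ordi d v)
      moment d k f (absc d v)
          = vertex_sum d k v by rewrite gt_eqF.
  rewrite /vertex_sum /level_sum big_mkcond [RHS]big_mkcond /=.
  apply: eq_bigr => f _.
  have [fv|/(moment_off st)->] := boolP (spans d f (absc d v)).
    by rewrite le_eqVlt (negPf (height_off nc fv)).
  by rewrite !if_same.
have [e [f [cor cor']]] := corridor_exists (moment_off st) M'M tot
  (lt0r_neq0 Sv) Sv'.
have [rfe lef] := corridor_ends nc st cor.
have [ref lfe] := corridor_ends nc' st' cor'.
have [_ _ + _ _] := cor; suff -> : e = f by rewrite ltxx.
by apply: (lend_rend_inj nc); apply: (absc_inj nc); apply/le_anti/andP; split.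
Qed.

Theorem stress_eq0 (R : realFieldType) (V E : finType)
    (d : diagram R V E) k g v :
  noncrossing_diagram d -> stress d k -> spans d g (absc d v) -> k g v = 0.
Proof.
move=> nc st gv; apply/le_anti/andP.
have := height_off nc gv; rewrite neq_lt => /orP[gy|yg]; split.
- exact (stress_above st gv gy).
- rewrite -oppr_le0.
  apply: (@stress_le0 _ _ _ (flip_y d) (fun g v => - k g v)).
  + exact: noncrossing_flip_y.
  + exact: stress_flip_y.
  + exact: gv.
  + by rewrite /= ltrN2.
- exact (stress_le0 nc st gv yg).
- exact (stress_below st gv yg).
Qed.

(** * Straightening a diagram *)

Section Straighten.
Variables (R : realFieldType) (V E : finType) (d : diagram R V E).
Hypothesis nc : noncrossing_diagram d.

Local Notation x := (absc d).
Local Notation y := (ordi d).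
Local Notation h := (height d).

(** The straight segment that replaces [e] when the vertices get the ordinates
[z]. *)
Definition chord (z : V -> R) e t :=
  ((x (rend d e) - t) * z (lend d e) + (t - x (lend d e)) * z (rend d e))
    / (x (rend d e) - x (lend d e)).

Definition side e v : R := if h e (x v) < y v then 1 else - 1.

(** The coefficients, in the unknown ordinates, of the condition that [v] lies
on the correct side of the chord of [e], multiplied by the width of [e].  Read
as forces, they are a load at [v] balanced by the supports at both ends. *)
Definition lever (p : E * V) : {ffun V -> R} :=
  let: (e, v) := p in
  [ffun w => side e v * ((x (rend d e) - x (lend d e)) * (w == v)%:R
                         - (x (rend d e) - x v) * (w == lend d e)%:R
                         - (x v - x (lend d e)) * (w == rend d e)%:R)].

Lemma width_gt0 e : 0 < x (rend d e) - x (lend d e).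
Proof. by rewrite subr_gt0 (lend_lt_rend nc). Qed.

Lemma sum_delta v (F : V -> R) : \sum_w (w == v)%:R * F w = F v.
Proof.
rewrite (bigD1 v) //= eqxx mul1r big1 ?addr0 // => w /negPf->.
by rewrite mul0r.
Qed.

Lemma lever_dot e v (F : V -> R) :
  \sum_w lever (e, v) w * F w
    = side e v * ((x (rend d e) - x (lend d e)) * F v
                  - (x (rend d e) - x v) * F (lend d e)
                  - (x v - x (lend d e)) * F (rend d e)).
Proof.
under eq_bigr do rewrite ffunE -mulrA !mulrBl -!mulrA.
by rewrite -mulr_sumr !sumrB -!mulr_sumr !sum_delta !mulrBl.
Qed.

Lemma lever_gt0 z e v : 0 < \sum_w lever (e, v) w * z w ->
  if h e (x v) < y v then chord z e (x v) < z v else z v < chord z e (x v).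
Proof.
rewrite lever_dot /side /chord; case: ifP => _.
  rewrite mul1r -addrA -opprD subr_gt0 ltr_pdivrMr ?width_gt0 //.
  by rewrite (mulrC (z v)).
rewrite mulN1r oppr_gt0 -addrA -opprD subr_lt0 ltr_pdivlMr ?width_gt0 //.
by rewrite (mulrC (z v)).
Qed.

Section Dual.
Variable c : E * V -> R.
Hypothesis c_ge0 : forall p, 0 <= c p.
Hypothesis c_dual : forall w,
  \sum_(p | spans d p.1 (x p.2)) c p * lever p w = 0.

Definition lever_kink e w :=
  - \sum_(v | spans d e (x v)) c (e, v) * lever (e, v) w.

Lemma spans_neq_ends e v : spans d e (x v) ->
  (v != lend d e) && (v != rend d e).
Proof.
by move=> /andP[lv vr]; apply/andP; split;
  [apply: contraTneq lv|apply: contraTneq vr] => ->; rewrite ltxx.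
Qed.

Lemma lever_kink_spans e w : spans d e (x w) ->
  lever_kink e w
    = - (c (e, w) * (side e w * (x (rend d e) - x (lend d e)))).
Proof.
move=> ew; have /andP[/negPf wl /negPf wr] := spans_neq_ends ew.
rewrite /lever_kink (bigD1 w) //= big1 ?addr0.
  by rewrite ffunE eqxx wl wr !mulr0 !subr0 mulr1.
move=> v /andP[_ /negPf vw].
by rewrite ffunE eq_sym vw wl wr !mulr0 !subr0 !mulr0.
Qed.

(** The moment of one lever is a tent over the interval of its edge: the
functional of the lever kills affine functions, and a ramp with its argument
outside the interval is affine at the three points involved. *)
Lemma lever_kink_stress : stress d lever_kink.
Proof.
split.
- move=> e v ev hy; rewrite lever_kink_spans // /side hy mul1r oppr_le0.
  by rewrite mulr_ge0 // ltW ?width_gt0.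
- move=> e v ev yh; rewrite lever_kink_spans // /side ltNge (ltW yh) /=.
  by rewrite mulN1r mulrN opprK mulr_ge0 // ltW ?width_gt0.
- move=> e w ew; rewrite /lever_kink big1 ?oppr0 // => v ev; rewrite ffunE.
  have /negPf-> : w != v by apply: contraNneq ew => ->; apply: spans_covers.
  have /negPf-> : w != lend d e.
    by apply: contraNneq ew => ->; apply: covers_lend.
  have /negPf-> : w != rend d e.
    by apply: contraNneq ew => ->; apply: covers_rend.
  by rewrite !mulr0 !subr0 !mulr0.
- move=> w; rewrite sumrN; apply/eqP; rewrite oppr_eq0 -[X in _ == X](c_dual w).
  rewrite pair_big_dep /=; apply/eqP; apply: eq_bigr => -[e v] _ //.
- move=> e t et; rewrite /moment /broken_line.
  under eq_bigr do rewrite mulNr mulr_suml.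
  rewrite sumrN exchange_big /= big1 ?oppr0 // => v /andP[lv vr].
  under eq_bigr do rewrite -mulrA.
  rewrite -mulr_sumr lever_dot.
  have [tl|ltd] := leP t (x (lend d e)).
    have tv := le_trans tl (ltW lv); have tr := le_trans tv (ltW vr).
    by rewrite !ramp_id // [X in _ * (_ * X)](_ : _ = 0) ?mulr0 //; ring.
  have rt : x (rend d e) <= t by move: et; rewrite /spans ltd /= -leNgt.
  have vt := le_trans (ltW vr) rt.
  by rewrite !ramp_eq0 ?(ltW ltd) // !mulr0 !subr0 !mulr0.
Qed.

End Dual.

(** By [stress_eq0] the dual weights of Gordan's theorem would have to
vanish. *)
Theorem exists_vertex_heights : exists z : V -> R,
  forall e v, spans d e (x v) ->
  if h e (x v) < y v then chord z e (x v) < z v else z v < chord z e (x v).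
Proof.
have [[z zpos]|[c [c0 [[e v] ev cpos] dual]]] :=
  gordan (fun p : E * V => spans d p.1 (x p.2)) lever.
  by exists z => e v ev; apply/lever_gt0/(zpos (e, v)).
have := stress_eq0 nc (lever_kink_stress c0 dual) ev.
rewrite /= lever_kink_spans //= => /eqP; rewrite oppr_eq0 !mulf_eq0.
rewrite (gt_eqF cpos) (gt_eqF (width_gt0 e)) orbF /side.
by case: ifP; rewrite ?oppr_eq0 oner_eq0.
Qed.

(** Order of the chords. *)
Lemma chord_lend z e : chord z e (x (lend d e)) = z (lend d e).
Proof.
by rewrite /chord subrr mul0r addr0 mulrAC mulfV ?mul1r // gt_eqF ?width_gt0.
Qed.

Lemma chord_rend z e : chord z e (x (rend d e)) = z (rend d e).
Proof.
by rewrite /chord subrr mul0r add0r mulrAC mulfV ?mul1r // gt_eqF ?width_gt0.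
Qed.

Lemma chord_end z e v : covers d e (x v) -> ~~ spans d e (x v) ->
  chord z e (x v) = z v.
Proof.
by move=> ev /(covers_spans nc ev)[]->; rewrite (chord_lend, chord_rend).
Qed.

Lemma chord_affine z e s t u :
  (u - s) * chord z e t = (u - t) * chord z e s + (t - s) * chord z e u.
Proof. by rewrite /chord; field; rewrite gt_eqF ?width_gt0. Qed.

Section Chords.
Variable z : V -> R.
Hypothesis zP : forall e v, spans d e (x v) ->
  if h e (x v) < y v then chord z e (x v) < z v else z v < chord z e (x v).

(** At an end [v] of one of the two edges, the comparison is between [v] and the
other edge, which the choice of [z] preserves. *)
Lemma chord_lt_vertex e f v : covers d e (x v) -> covers d f (x v) ->
  ~~ (spans d e (x v) && spans d f (x v)) -> h e (x v) < h f (x v) ->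
  chord z e (x v) < chord z f (x v).
Proof.
move=> ev fv nsp ef; have [ev_sp|ev_end] := boolP (spans d e (x v)).
  have fv_end : ~~ spans d f (x v) by rewrite ev_sp in nsp.
  move: ef; rewrite (height_end nc fv fv_end) (chord_end _ fv fv_end) => ef.
  by have := zP ev_sp; rewrite ef.
move: ef; rewrite (height_end nc ev ev_end) (chord_end _ ev ev_end) => ef.
have [fv_sp|fv_end] := boolP (spans d f (x v)); last first.
  by move: ef; rewrite (height_end nc fv fv_end) ltxx.
by have := zP fv_sp; rewrite ltNge (ltW ef).
Qed.

Section Overlap.
Variables (e f : E) (t : R).
Hypotheses (et : covers d e t) (ft : covers d f t).
Hypotheses (sp : spans d e t || spans d f t) (ef : h e t < h f t).

Let s := overlap_l d e f.
Let u := overlap_r d e f.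

Lemma overlap_cover w : s <= w -> w <= u -> covers d e w && covers d f w.
Proof.
rewrite /s /u ge_max le_min => /andP[le_ lf] /andP[re rf].
by rewrite /covers le_ lf re rf.
Qed.

(** At an extremity of the common interval some edge ends.  If both do, it is at
the same vertex and the chords agree there. *)
Lemma overlap_point w v : w = x v -> s <= w -> w <= u ->
    (w == s) || (w == u) ->
  chord z e w <= chord z f w /\
  (spans d e w || spans d f w -> chord z e w < chord z f w).
Proof.
move=> -> sw wu end_w; have /andP[ew fw] := overlap_cover sw wu.
have strict : spans d e (x v) || spans d f (x v) ->
    chord z e (x v) < chord z f (x v).
  move=> spw; apply: chord_lt_vertex => //; last exact: (height_lt nc et ft).
  rewrite -spans_overlap -/s -/u.
  by case/orP: end_w => /eqP->; rewrite ltxx ?andbF.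
split=> //; have [/strict/ltW//|] := boolP (spans d e (x v) || spans d f (x v)).
rewrite negb_or => /andP[ew_end fw_end].
by rewrite (chord_end _ ew ew_end) (chord_end _ fw fw_end).
Qed.

(** The difference of the chords is affine, nonnegative at both extremities of
the common interval, and positive at one of them, since otherwise the edges
would share both ends. *)
Lemma chord_lt : chord z e t < chord z f t.
Proof.
have su : s < u := overlap_lt nc et ft sp.
have [st tu] : s <= t /\ t <= u.
  move/andP: et => [let_ tre]; move/andP: ft => [lft trf].
  by rewrite /s /u ge_max le_min let_ tre lft trf.
have [vs sE] : exists v, s = x v.
  by rewrite /s /overlap_l; case: (leP (x (lend d e))); eexists.
have [vu uE] : exists v, u = x v.
  by rewrite /u /overlap_r; case: (leP (x (rend d e))); eexists.
have [les lts] := overlap_point sE (lexx s) (ltW su)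
  (introT orP (or_introl (eqxx _))).
have [leu ltu] := overlap_point uE (ltW su) (lexx u)
  (introT orP (or_intror (eqxx _))).
have [ts|ts] := eqVneq t s; first by rewrite ts; apply: lts; rewrite -ts.
have [tu'|tu'] := eqVneq t u; first by rewrite tu'; apply: ltu; rewrite -tu'.
have {ts}st : s < t by rewrite lt_neqAle eq_sym ts.
have {tu'}tu : t < u by rewrite lt_neqAle tu'.
rewrite -subr_gt0 -(pmulr_rgt0 _ (_ : 0 < u - s)) ?subr_gt0 //.
rewrite mulrBr !(chord_affine _ _ s t u) opprD addrACA -!mulrBr.
have ps : 0 <= (u - t) * (chord z f s - chord z e s).
  by rewrite mulr_ge0 // subr_ge0 // ltW.
have pu : 0 <= (t - s) * (chord z f u - chord z e u).
  by rewrite mulr_ge0 // subr_ge0 // ltW.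
(* If no edge passes over an extremity, both edges end there. *)
have [sps|] := boolP (spans d e s || spans d f s).
  by rewrite ltr_pwDl // mulr_gt0 // subr_gt0 // lts.
have [spu _|] := boolP (spans d e u || spans d f u).
  by rewrite ltr_wpDl // mulr_gt0 // subr_gt0 // ltu.
rewrite !negb_or => /andP[eu fu] /andP[es fs].
suff efE : e = f by move: ef; rewrite efE ltxx.
have [sl_e sl_f ur_e ur_f] : [/\ x (lend d e) <= s, x (lend d f) <= s,
    u <= x (rend d e) & u <= x (rend d f)].
  by rewrite !le_max !ge_min !lexx !orbT.
have lendE g : x (lend d g) <= s -> u <= x (rend d g) -> ~~ spans d g s ->
    x (lend d g) = s.
  move=> ls ur; rewrite /spans (lt_le_trans su ur) andbT -leNgt => sl.
  by apply/le_anti; rewrite ls.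
have rendE g : x (lend d g) <= s -> u <= x (rend d g) -> ~~ spans d g u ->
    x (rend d g) = u.
  move=> ls ur; rewrite /spans (le_lt_trans ls su) /= -leNgt => ru.
  by apply/le_anti; rewrite ur andbT.
apply: (lend_rend_inj nc); apply: (absc_inj nc).
  by rewrite (lendE e) // (lendE f).
by rewrite (rendE e) // (rendE f).
Qed.
End Overlap.

End Chords.

(** The converse implication of [chord_lt] follows because distinct edges are
never at the same height where one of them is interior. *)
Theorem exists_chord_order : exists z : V -> R,
  (forall e v, spans d e (x v) -> chord z e (x v) != z v) /\
  (forall e f t, e != f -> covers d e t -> covers d f t ->
    spans d e t || spans d f t ->
    (chord z e t < chord z f t) = (h e t < h f t)).
Proof.
have [z zP] := exists_vertex_heights; exists z.
split=> [e v /zP|e f t ef et ft sp].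
  by case: ifP => _; [move/lt_eqF->|move/gt_eqF->].
apply/idP/idP; last exact: chord_lt.
apply: contraTT; rewrite -!leNgt le_eqVlt => /predU1P[hfe|].
  case/orP: sp => sp; first by have /eqP := height_neq nc ef sp ft; rewrite hfe.
  by rewrite eq_sym in ef; have /eqP := height_neq nc ef sp et.
by move=> fe; apply/ltW/chord_lt; rewrite 1?orbC.
Qed.

Definition chord_diagram z : diagram R V E :=
  Diagram x z (lend d) (rend d) (chord z).

Theorem straighten_diagram : exists z, noncrossing_diagram (chord_diagram z) /\
  forall e f, lower (chord_diagram z) e f = lower d e f.
Proof.
have [z [zoff zlt]] := exists_chord_order; exists z; split; last first.
  move=> e f; have [->|ef] := eqVneq e f; first by rewrite /lower !ltxx !andbF.
  have [lr|rl] := ltP (overlap_l d e f) (overlap_r d e f); last first.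
    by rewrite /lower /= ltNge rl.
  have /andP[em fm] := spans_overlap_mid lr.
  rewrite /lower [in RHS]lr -[LHS]/(_ && _) /= [X in X && _]lr.
  by rewrite (zlt _ _ _ ef (spans_covers em) (spans_covers fm)) ?em.
have ends e f t : covers d e t -> covers d f t ->
    ~~ (spans d e t || spans d f t) -> chord z e t = chord z f t.
  rewrite negb_or => et ft /andP[et_end ft_end].
  have [v tv] : exists v, t = x v.
    move: et et_end; rewrite /covers /spans => /andP[].
    rewrite !le_eqVlt => /predU1P[<- _ _|->]; first by eexists.
    by move=> /predU1P[->|->//]; eexists.
  by rewrite tv in et ft et_end ft_end *; rewrite !chord_end.
split=> //=.
- exact: absc_inj nc.
- exact: lend_lt_rend nc.
- exact: chord_lend.
- exact: chord_rend.
- move=> e f t ef et ft; have et' : spans d e t := et.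
  have etc := spans_covers et'; have fe : f != e by rewrite eq_sym.
  have := height_neq nc ef et ft; rewrite !neq_lt => /orP[lt_ef|lt_fe].
    by apply/orP; left; rewrite zlt // et'.
  by apply/orP; right; rewrite zlt // et' orbT.
- move=> e f s t es fs et ft lt_s; have ef : e != f.
    by apply: contraTneq lt_s => ->; rewrite ltxx.
  have [sps|/(ends _ _ _ es fs) eq_s] := boolP (spans d e s || spans d f s);
    last by rewrite eq_s ltxx in lt_s.
  have [spt|/(ends _ _ _ et ft) -> //] := boolP (spans d e t || spans d f t).
  rewrite zlt // in lt_s; apply: ltW; rewrite zlt //.
  exact: (height_lt nc es fs).
- exact: lend_rend_inj nc.
Qed.

End Straighten.

(** * Monotone arcs are graphs *)

Section ArcGraph.
Variable R : realType.
Local Open Scope classical_set_scope.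
Local Open Scope ring_scope.

Definition graph_on (a b : R) (h : R -> R) : set (R * R) :=
  [set p | a <= p.1 <= b /\ p.2 = h p.1].

Lemma within_continuous_comp (T : topologicalType) (A B : set R) (g : R -> R)
    (f : R -> T) :
  {within A, continuous g} -> {within B, continuous f} ->
  (forall t, A t -> B (g t)) -> {within A, continuous (f \o g)}.
Proof.
move=> /subspace_continuousP cg /subspace_continuousP cf gAB.
apply/subspace_continuousP => t At.
move=> P nP.
have nB : nbhs (g t) [set s | B s -> P (f s)] := cf _ (gAB t At) P nP.
have nA : nbhs t [set s | A s -> B (g s) -> P (f (g s))] := cg t At _ nB.
by apply: filterS nA => s APs As; apply: APs => //; apply: gAB.
Qed.

Lemma within_continuous_post (U T : topologicalType) (A : set R) (g : R -> U)
    (f : U -> T) :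
  {within A, continuous g} -> continuous f -> {within A, continuous (f \o g)}.
Proof.
move=> /subspace_continuousP cg cf; apply/subspace_continuousP => t At.
exact: cvg_comp (cg t At) (cf (g t)).
Qed.

(** The first coordinate of the parametrization is continuous and injective,
hence a homeomorphism onto its image; the height is the second coordinate
composed with its inverse. *)
Lemma monotone_arc_graph (A : set (R * R)) (a b : R * R) :
  jordan_arc A a b -> a.1 < b.1 ->
  (forall p q, A p -> A q -> p.1 = q.1 -> p = q) ->
  exists h, {within `[a.1, b.1], continuous h} /\ A = graph_on a.1 b.1 h.
Proof.
move=> [c [cc cinj c0 c1 cA]] ab mono.
have I0 : (0 : R) \in `[0, 1] by rewrite in_itv /= lexx ler01.
have I1 : (1 : R) \in `[0, 1] by rewrite in_itv /= lexx ler01.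
have inA t : t \in `[0, 1] -> A (c t) by move=> It; rewrite -cA; exists t.
pose F := fst \o c.
have cF : {within `[0, 1], continuous F}.
  by apply: within_continuous_post cc _ => p; apply: cvg_fst.
have Finj : {in `[0, 1] &, injective F}.
  by move=> s t Is It /(mono _ _ (inA s Is) (inA t It)); apply: cinj.
have F0 : F 0 = a.1 by rewrite /F /= c0.
have F1 : F 1 = b.1 by rewrite /F /= c1.
have F01 : F 0 <= F 1 by rewrite F0 F1 ltW.
have Fmono := segment_continuous_inj_le F01 cF Finj.
(* The inverse of [F] on its image; the default value 0 is never used there. *)
pose g u := xget 0 [set t | t \in `[0, 1] /\ F t = u].
have gP u : u \in `[a.1, b.1] -> g u \in `[0, 1] /\ F (g u) = u.
  move=> Iu; have [|t It Ftu] := IVT ler01 cF (v := u).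
    by rewrite (min_idPl F01) (max_idPr F01) F0 F1; move: Iu; rewrite in_itv.
  by apply: (@xgetPex _ 0 [set t | t \in `[0, 1] /\ F t = u]); exists t.
have FI t : t \in `[0, 1] -> F t \in `[a.1, b.1].
  move=> It; rewrite in_itv /= -F0 -F1 !Fmono //.
have gK : {in `[0, 1], cancel F g}.
  by move=> t It; have [Ig] := gP _ (FI t It); apply: Finj.
have cg : {within `[a.1, b.1], continuous g}.
  by rewrite -F0 -F1; apply: segment_can_le_continuous.
exists (snd \o c \o g); split.
  apply: (within_continuous_comp (B := `[0, 1]) cg); last first.
    by move=> t It; apply: (gP t _).1.
  by apply: within_continuous_post cc _ => p; apply: cvg_snd.
apply/seteqP; split=> [p Ap|p [Ip p2]].
  move: (Ap); rewrite -cA => -[t It ctp]; have := FI t It.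
  rewrite in_itv /F /= ctp => Ip; split=> //=.
  by rewrite -ctp /= -[in RHS]/(F t) gK.
have [Ig Fg] := gP p.1 Ip.
suff -> : p = c (g p.1) by apply: inA.
have p1 : p.1 = (c (g p.1)).1 by rewrite -[LHS]Fg.
by rewrite [LHS]surjective_pairing p2 [X in (X, _)]p1 /= -surjective_pairing.
Qed.

Lemma segment_graph (a b : R * R) : a.1 < b.1 ->
  segment a b = graph_on a.1 b.1
    (fun t => ((b.1 - t) * a.2 + (t - a.1) * b.2) / (b.1 - a.1)).
Proof.
move=> ab; have ab0 : 0 < b.1 - a.1 by rewrite subr_gt0.
have ab_neq0 : b.1 - a.1 != 0 by rewrite gt_eqF.
apply/seteqP; split=> [_ [t It <-]|p [/andP[ap pb] p2]] /=.
  move: It; rewrite /= in_itv /= => /andP[t0 t1].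
  split; last by rewrite /=; field.
  rewrite -subr_ge0 -[X in _ && X]subr_ge0.
  have -> : (1 - t) * a.1 + t * b.1 - a.1 = t * (b.1 - a.1) by ring.
  have -> : b.1 - ((1 - t) * a.1 + t * b.1) = (1 - t) * (b.1 - a.1) by ring.
  by rewrite !mulr_ge0 ?subr_ge0 // ltW.
exists ((p.1 - a.1) / (b.1 - a.1)).
  rewrite /= in_itv /= divr_ge0 ?subr_ge0 ?(ltW ab) //=.
  by rewrite ler_pdivrMr // mul1r lerD2r.
rewrite [RHS]surjective_pairing p2; congr (_, _); by field.
Qed.

End ArcGraph.

(** * Drawings and diagrams *)

Section Represents.
Variables (R : realType) (G : sgraph).
Local Open Scope classical_set_scope.
Local Open Scope ring_scope.

Definition edge := {f : {set G} | f \in edges G}.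

Implicit Types (D : layout R G) (d : diagram R G edge) (e f : edge) (v : G).

(** The diagram records the heights of the edges of the layout; the values of
[arc D] outside the edge set stay arbitrary. *)
Record represents D d : Prop := {
  rep_pos : forall v, pos D v = (absc d v, ordi d v);
  rep_ends : forall e, val e = [set lend d e; rend d e]%SET;
  rep_arc : forall e, arc D (val e)
    = graph_on (absc d (lend d e)) (absc d (rend d e)) (height d e);
  rep_cont : forall e,
    {within `[absc d (lend d e), absc d (rend d e)], continuous (height d e)}
}.

Lemma edge_ends D (f : {set G}) : injective (fun v => (pos D v).1) ->
  f \in edges G ->
  exists uv : G * G,
    f = [set uv.1; uv.2]%SET /\ (pos D uv.1).1 < (pos D uv.2).1.
Proof.
move=> inj /edges_card2/eqP/cards2P[u [v [uv ->]]].
have: (pos D u).1 != (pos D v).1 by apply: contra_neq uv => /inj.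
rewrite neq_lt => /orP[lt_uv|lt_vu]; first by exists (u, v).
by exists (v, u); rewrite finset.setUC.
Qed.

Section DiagramOfDrawing.
Variable D : layout R G.
Hypotheses (hD : is_drawing D) (hmono : x_monotone D) (hnc : noncrossing D).

Lemma drawing_represented : exists d, represents D d /\
  forall e, absc d (lend d e) < absc d (rend d e).
Proof.
have ends (e : edge) := edge_ends (drawing_abscissa hD) (valP e).
have [uv uvP] := choice ends.
have graphs (e : edge) : exists h : R -> R,
    {within `[(pos D (uv e).1).1, (pos D (uv e).2).1], continuous h} /\
    arc D (val e) = graph_on (pos D (uv e).1).1 (pos D (uv e).2).1 h.
  have [eE lt_uv] := uvP e; apply: monotone_arc_graph => //.
    by rewrite eE; apply: (drawing_arc hD); rewrite -eE; apply: valP.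
  by move=> p q ep eq pq; apply: (hmono (valP e) ep eq _ erefl).
have [h hP] := choice graphs.
exists (Diagram (fun v => (pos D v).1) (fun v => (pos D v).2)
  (fun e => (uv e).1) (fun e => (uv e).2) h).
split=> [|e]; last exact: (uvP e).2.
split=> /= [v|e|e|e].
- exact: surjective_pairing.
- exact: (uvP e).1.
- exact: (hP e).2.
- exact: (hP e).1.
Qed.

Variable d : diagram R G edge.
Hypotheses (rep : represents D d).
Hypothesis lr : forall e, absc d (lend d e) < absc d (rend d e).

Lemma arcE e p : arc D (val e) p <-> covers d e p.1 /\ p.2 = height d e p.1.
Proof. by rewrite (rep_arc rep). Qed.

Lemma arc_jordan e :
  jordan_arc (arc D (val e)) (pos D (lend d e)) (pos D (rend d e)).
Proof.
rewrite (rep_ends rep); apply: (drawing_arc hD).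
by rewrite -(rep_ends rep) (valP e).
Qed.

Lemma arc_pos e v : v = lend d e \/ v = rend d e -> arc D (val e) (pos D v).
Proof.
have [c [_ _ c0 c1 cA]] := arc_jordan e.
by case=> ->; rewrite -cA; [exists 0|exists 1] => //=;
  rewrite in_itv /= ?lexx ?ler01.
Qed.

Lemma spans_notin e v : spans d e (absc d v) -> v \notin val e.
Proof.
rewrite (rep_ends rep) => /andP[lv vr]; apply/negP => /set2P[] vE.
  by rewrite vE ltxx in lv.
by rewrite vE ltxx in vr.
Qed.

Lemma drawing_height_off e v : spans d e (absc d v) ->
  height d e (absc d v) != ordi d v.
Proof.
move=> ev; apply/eqP => hy.
apply: (drawing_vertex hD (valP e) (spans_notin ev)); apply/arcE.
by rewrite (rep_pos rep); split=> //; apply: spans_covers.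
Qed.

(** A common point would be interior to [e]; it cannot be a vertex of [f], since
edges avoid the other vertices, and at a common interior point two edges of a
drawing cross. *)
Lemma drawing_height_neq e f t : e != f -> spans d e t -> covers d f t ->
  height d e t != height d f t.
Proof.
move=> ef et ft; apply/eqP => hef; pose p := (t, height d e t).
have ep : arc D (val e) p by apply/arcE; split=> //; apply: spans_covers.
have fp : arc D (val f) p by apply/arcE; split=> //=.
have notin v : pos D v = p -> v \notin val e.
  rewrite (rep_pos rep) => -[vt _]; apply: spans_notin; by rewrite vt.
have ei : arc_interior D (val e) p.
  split=> // -[v /= ve vp]; by have := notin v vp; rewrite ve.
have fi : arc_interior D (val f) p.
  split=> // -[v /= vf vp].
  by apply: (drawing_vertex hD (valP e) (notin v vp)); rewrite vp.
have ef' : val e != val f by rewrite (inj_eq val_inj).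
apply: (hnc (valP e) (valP f) ef' (p := p)); split=> //.
exact: (drawing_proper hD (valP e) (valP f) ef').
Qed.

(** If the order changed, the intermediate value theorem would give equal
heights strictly between [s] and [t]. *)
Lemma drawing_height_le e f s t :
  covers d e s -> covers d f s -> covers d e t -> covers d f t ->
  height d e s < height d f s -> height d e t <= height d f t.
Proof.
move=> es fs et ft ef_s; rewrite leNgt; apply/negP => fe_t.
have ef : e != f by apply: contraTneq ef_s => ->; rewrite ltxx.
pose F u := height d e u - height d f u.
have Fs : F s < 0 by rewrite subr_lt0.
have Ft : 0 < F t by rewrite subr_gt0.
have cover g a b u : covers d g a -> covers d g b -> u \in `[a, b] ->
    covers d g u.
  move=> /andP[la _] /andP[_ rb]; rewrite in_itv /= => /andP[au ub].
  by rewrite /covers (le_trans la) // (le_trans ub).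
have no_zero a b : covers d e a -> covers d f a -> covers d e b ->
    covers d f b -> a < b -> Num.min (F a) (F b) < 0 < Num.max (F a) (F b) ->
    False.
  move=> ea fa eb fb ab /andP[Fmin Fmax].
  have cont g : covers d g a -> covers d g b ->
      {within `[a, b], continuous (height d g)}.
    move=> ga gb.
    apply: (continuous_subspaceW _ (rep_cont rep (e := g))) => u /= uab.
    by rewrite in_itv /=; apply: (cover g a b).
  have cF : {within `[a, b], continuous F}.
    by move=> u; apply: cvgB; [exact: cont|exact: cont].
  have [|u uab Fu] := IVT (ltW ab) cF (v := 0); first by rewrite !ltW.
  have [au ub] : a < u /\ u < b.
    move: uab; rewrite in_itv /= => /andP[].
    rewrite !le_eqVlt => /predU1P[ua|au] /predU1P[ub|ub] //; exfalso.
    - by move: ab; rewrite ua ub ltxx.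
    - move: Fmin Fmax; rewrite ua Fu gt_min lt_max ltxx /= => Fb.
      by rewrite ltNge (ltW Fb).
    - move: Fmin Fmax; rewrite -ub Fu gt_min lt_max ltxx !orbF => Fa.
      by rewrite ltNge (ltW Fa).
  have fu := cover f a b u fa fb uab.
  have eu : spans d e u.
    move/andP: ea => [la _]; move/andP: eb => [_ rb].
    by rewrite /spans (le_lt_trans la) // (lt_le_trans ub).
  by have := drawing_height_neq ef eu fu; rewrite -subr_eq0 -/(F u) Fu eqxx.
have FtFs : F s <= F t by rewrite ltW // (lt_trans Fs).
have [st|ts|st] := ltgtP s t.
- by apply: (no_zero s t) => //; rewrite (min_idPl FtFs) (max_idPr FtFs) Fs.
- by apply: (no_zero t s) => //; rewrite (min_idPr FtFs) (max_idPl FtFs) Fs.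
- by move: (lt_trans Fs Ft); rewrite st ltxx.
Qed.

Lemma drawing_diagram : noncrossing_diagram d.
Proof.
split.
- by move=> u v uv; apply: (drawing_abscissa hD); rewrite !(rep_pos rep).
- exact: lr.
- by move=> e; have /arcE[_] := arc_pos (or_introl (erefl (lend d e)));
    rewrite (rep_pos rep) /= => ->.
- by move=> e; have /arcE[_] := arc_pos (or_intror (erefl (rend d e)));
    rewrite (rep_pos rep) /= => ->.
- exact: drawing_height_off.
- exact: drawing_height_neq.
- exact: drawing_height_le.
- by move=> e f el er; apply: val_inj; rewrite /= !(rep_ends rep) el er.
Qed.

End DiagramOfDrawing.

(** * Local structure at a vertex *)

Section Local.
Variables (D : layout R G) (d : diagram R G edge).
Hypotheses (rep : represents D d) (nc : noncrossing_diagram d).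

(** By continuity of the height, the edge has points in every neighbourhood of
its ends.  This is what makes the local order relations of a drawing
non-vacuous. *)
Lemma near_lend e P : nbhs (pos D (lend d e)) P ->
  \forall t \near (absc d (lend d e))^'+, spans d e t /\ P (t, height d e t).
Proof.
set a := absc d (lend d e) => nP.
have ca : height d e @ within `[a, absc d (rend d e)] (nbhs a) --> height d e a.
  have /subspace_continuousP hc := rep_cont rep (e := e); apply: hc.
  by rewrite /= in_itv /= lexx ltW // (lend_lt_rend nc).
have cp : (t, height d e t) @[t --> within `[a, absc d (rend d e)] (nbhs a)]
    --> (a, height d e a).
  exact: (cvg_pair (f := id) (cvg_within _) ca).
have nP' : nbhs (a, height d e a) P.
  by rewrite (height_lend nc) -(rep_pos rep).
have /= near_a := cp _ nP'.
have near_a' : \forall t \near a^'+,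
    t \in `[a, absc d (rend d e)] -> P (t, height d e t).
  have nQ : nbhs a [set t | t \in `[a, absc d (rend d e)] ->
    P (t, height d e t)] := near_a.
  by apply: filterS nQ => t + _.
near=> t.
have ta : a < t by near: t; apply: nbhs_right_gt.
have tr : t < absc d (rend d e).
  by near: t; apply: nbhs_right_lt; apply: lend_lt_rend nc e.
split; first by rewrite /spans ta.
have /(_ _) : t \in `[a, absc d (rend d e)] -> P (t, height d e t) by near: t.
by apply; rewrite in_itv /= !ltW.
Unshelve. all: by end_near.
Qed.

Lemma near_rend e P : nbhs (pos D (rend d e)) P ->
  \forall t \near (absc d (rend d e))^'-, spans d e t /\ P (t, height d e t).
Proof.
set b := absc d (rend d e) => nP.
have ca : height d e @ within `[absc d (lend d e), b] (nbhs b) --> height d e b.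
  have /subspace_continuousP hc := rep_cont rep (e := e); apply: hc.
  by rewrite /= in_itv /= lexx andbT ltW // (lend_lt_rend nc).
have cp : (t, height d e t) @[t --> within `[absc d (lend d e), b] (nbhs b)]
    --> (b, height d e b).
  exact: (cvg_pair (f := id) (cvg_within _) ca).
have nP' : nbhs (b, height d e b) P.
  by rewrite (height_rend nc) -(rep_pos rep).
have /= near_a := cp _ nP'.
have near_a' : \forall t \near b^'-,
    t \in `[absc d (lend d e), b] -> P (t, height d e t).
  have nQ : nbhs b [set t | t \in `[absc d (lend d e), b] ->
    P (t, height d e t)] := near_a.
  by apply: filterS nQ => t + _.
near=> t.
have tb : t < b by near: t; apply: nbhs_left_lt.
have lt_ : absc d (lend d e) < t.
  by near: t; apply: nbhs_left_gt; apply: lend_lt_rend nc e.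
split; first by rewrite /spans lt_.
have /(_ _) : t \in `[absc d (lend d e), b] -> P (t, height d e t) by near: t.
by apply; rewrite in_itv /= !ltW.
Unshelve. all: by end_near.
Qed.

Definition common_end v e f :=
  lend d e = v /\ lend d f = v \/ rend d e = v /\ rend d f = v.

Lemma approach_end v e f P : common_end v e f -> nbhs (pos D v) P ->
  exists t, [/\ spans d e t, spans d f t, P (t, height d e t)
               & P (t, height d f t)].
Proof.
case=> -[ev fv] nP.
- have nE := @near_lend e P; have nF := @near_lend f P.
  rewrite ev in nE; rewrite fv in nF.
  have [t [[et eP] [ft fP]]] := filter_ex (filterI (nE nP) (nF nP)).
  by exists t.
- have nE := @near_rend e P; have nF := @near_rend f P.
  rewrite ev in nE; rewrite fv in nF.
  have [t [[et eP] [ft fP]]] := filter_ex (filterI (nE nP) (nF nP)).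
  by exists t.
Qed.

Lemma rep_arcE e p : arc D (val e) p <-> covers d e p.1 /\ p.2 = height d e p.1.
Proof. by rewrite (rep_arc rep). Qed.

Lemma rep_on_end e p v : arc D (val e) p -> p.1 = absc d v ->
  v \in val e -> p = pos D v.
Proof.
move=> /rep_arcE[_ p2] p1; rewrite (rep_ends rep) (rep_pos rep).
by rewrite [p]surjective_pairing p2 p1 => /set2P[]->;
  rewrite (height_lend nc, height_rend nc).
Qed.

Lemma spans_neq_end e v t : v \in val e -> spans d e t ->
  (t, height d e t) <> pos D v.
Proof.
rewrite (rep_pos rep) (rep_ends rep) => /set2P[]-> /andP[lt_ tr] [tE _].
  by rewrite tE ltxx in lt_.
by rewrite tE ltxx in tr.
Qed.

Lemma spans_arc e t : spans d e t -> arc D (val e) (t, height d e t).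
Proof. by move=> et; apply/rep_arcE; split=> //; apply: spans_covers. Qed.

Lemma leaves_rightP v e : v \in val e ->
  leaves_right D v (val e) <-> v = lend d e.
Proof.
move=> ve; split=> [lr|vE].
  move: (ve); rewrite (rep_ends rep) => /set2P[//|vE].
  have [t [et _ far _]] :=
    approach_end (or_intror (conj (esym vE) (esym vE))) lr.
  have := far (spans_arc et) (spans_neq_end ve et).
  by rewrite (rep_pos rep) vE /= ltNge ltW //; case/andP: et.
apply: (@filterE _ (nbhs (pos D v))) => p ep pv.
have /rep_arcE[/andP[lp _] _] := ep.
rewrite (rep_pos rep) vE /= lt_neqAle lp andbT.
apply: contra_notN pv => /eqP p1.
by apply: (rep_on_end ep) => //; rewrite -p1 vE.
Qed.

Lemma leaves_leftP v e : v \in val e ->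
  leaves_left D v (val e) <-> v = rend d e.
Proof.
move=> ve; split=> [ll|vE].
  move: (ve); rewrite (rep_ends rep) => /set2P[vE|//].
  have [t [et _ far _]] :=
    approach_end (or_introl (conj (esym vE) (esym vE))) ll.
  have := far (spans_arc et) (spans_neq_end ve et).
  by rewrite (rep_pos rep) vE /= ltNge ltW //; case/andP: et.
apply: (@filterE _ (nbhs (pos D v))) => p ep pv.
have /rep_arcE[/andP[_ pr] _] := ep.
rewrite (rep_pos rep) vE /= lt_neqAle pr andbT.
apply: contra_notN pv => /eqP p1.
by apply: (rep_on_end ep) => //; rewrite p1 vE.
Qed.

Lemma common_end_spans v e f t : common_end v e f -> e != f ->
  covers d e t -> covers d f t -> t != absc d v -> spans d e t || spans d f t.
Proof.
move=> cm ef /andP[et te] /andP[ft tf] tv; apply: contraNT ef; rewrite negb_or.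
case: cm => -[ev fv]; rewrite /spans.
- rewrite ![absc d (lend d _) < _]lt_neqAle et ft ev fv eq_sym tv /= -!leNgt.
  move=> /andP[re rf]; apply/eqP/(lend_rend_inj nc); first by rewrite ev.
  apply: (absc_inj nc).
  rewrite (le_anti (introT andP (conj re te))).
  by rewrite (le_anti (introT andP (conj rf tf))).
- rewrite ![_ < absc d (rend d _)]lt_neqAle te tf ev fv tv /= !andbT -!leNgt.
  move=> /andP[re rf]; apply/eqP/(lend_rend_inj nc); last by rewrite ev.
  apply: (absc_inj nc).
  rewrite (le_anti (introT andP (conj et re))).
  by rewrite (le_anti (introT andP (conj ft rf))).
Qed.

(** The order of two edges near a common end is their order over the whole
common interval, hence the one recorded by [lower]. *)
Lemma lies_aboveP v e f : common_end v e f ->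
  lies_above D v (val e) (val f) <-> lower d f e.
Proof.
move=> cm; have [ve vf] : v \in val e /\ v \in val f.
  by rewrite !(rep_ends rep); case: cm => -[<- <-]; rewrite !inE !eqxx ?orbT.
split=> [[[P Q] /= [nP nQ] PQ]|fe].
  have [t [et ft [Pe _] [_ Qf]]] := approach_end cm (filterI nP nQ).
  rewrite (lowerE nc (spans_covers ft) (spans_covers et)) ?ft //.
  apply: (PQ ((t, height d e t), (t, height d f t)) (conj Pe Qf)) => //.
  - exact: spans_arc.
  - exact: spans_arc.
  - exact: spans_neq_end.
  - exact: spans_neq_end.
have ef : f != e by apply: contraTneq fe => ->; rewrite /lower ltxx andbF.
exists (setT, setT); first by split; apply: filterT.
move=> [p q] _ /= ep fq pv _ pq.
have /rep_arcE[et p2] := ep; have /rep_arcE[] := fq; rewrite -pq => ft q2.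
have tv : p.1 != absc d v.
  by apply: contra_notN pv => /eqP p1; apply: (rep_on_end ep).
rewrite p2 q2 -(lowerE nc ft et) // orbC (common_end_spans cm) //.
by rewrite eq_sym.
Qed.

End Local.
End Represents.

(** * The straight-line drawing *)

Section StraightLayout.
Variables (R : realType) (G : sgraph).
Local Open Scope classical_set_scope.
Local Open Scope ring_scope.
Implicit Types (d : diagram R G (edge G)) (e f : edge G) (v : G).

Lemma segment_sym (a b : R * R) : segment a b = segment b a.
Proof.
have sub (c c' : R * R) : segment c c' `<=` segment c' c; last first.
  by apply/seteqP; split; apply: sub.
move=> _ [t + <-]; rewrite /= in_itv /= => /andP[t0 t1].
exists (1 - t); first by rewrite /= in_itv /= subr_ge0 t1 lerBlDr lerDl.
by rewrite subKr; congr (_, _); rewrite addrC.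
Qed.

Lemma affine_continuous (a b : R) :
  continuous (fun t : R => (1 - t) * a + t * b).
Proof.
move=> t; apply: cvgD; apply: cvgM; try exact: cvg_cst; last exact: cvg_id.
by apply: cvgB; [exact: cvg_cst|exact: cvg_id].
Qed.

Lemma segment_jordan (a b : R * R) : a.1 != b.1 -> jordan_arc (segment a b) a b.
Proof.
move=> ab; exists (fun t => ((1 - t) * a.1 + t * b.1, (1 - t) * a.2 + t * b.2)).
split.
- apply: continuous_subspaceT => t.
  exact: (cvg_pair (@affine_continuous a.1 b.1 t)
                   (@affine_continuous a.2 b.2 t)).
- move=> s t _ _ [+ _] => /eqP.
  have aff u : (1 - u) * a.1 + u * b.1 = a.1 + u * (b.1 - a.1) by ring.
  rewrite !aff (inj_eq (addrI _)) (inj_eq (mulIf _)) ?subr_eq0 1?eq_sym //.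
  by move=> /eqP.
- by rewrite subr0 !mul1r !mul0r !addr0 -surjective_pairing.
- by rewrite subrr !mul1r !mul0r !add0r -surjective_pairing.
- by [].
Qed.

Definition straight_layout d : layout R G :=
  let p v := (absc d v, ordi d v) in
  Layout p (fun A => if insub A is Some e
                     then segment (p (lend d e)) (p (rend d e)) else set0).

Lemma straight_layout_arc d e : arc (straight_layout d) (val e)
  = segment (pos (straight_layout d) (lend d e))
            (pos (straight_layout d) (rend d e)).
Proof. by rewrite /= valK. Qed.

Lemma chord_continuous d z e : continuous (chord d z e).
Proof.
move=> t; rewrite /chord; apply: cvgM; last exact: cvg_cst.
apply: cvgD; apply: cvgM; try exact: cvg_cst.
  by apply: cvgB; [exact: cvg_cst|exact: cvg_id].
by apply: cvgB; [exact: cvg_id|exact: cvg_cst].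
Qed.

Lemma straight_layout_represented d z : noncrossing_diagram d ->
  (forall e, val e = [set lend d e; rend d e]%SET) ->
  represents (straight_layout (chord_diagram d z)) (chord_diagram d z).
Proof.
move=> nc ends; split=> //= e.
- by rewrite valK segment_graph //= (lend_lt_rend nc).
- by apply: continuous_subspaceT; apply: chord_continuous.
Qed.

Section Realized.
Variables (D : layout R G) (d : diagram R G (edge G)).
Hypotheses (rep : represents D d) (nc : noncrossing_diagram d).

Lemma represents_x_monotone : x_monotone D.
Proof.
move=> f fE x p q; rewrite -[f]/(val (exist _ f fE : edge G)).
move=> /(rep_arcE rep)[_ p2] /(rep_arcE rep)[_ q2] px qx.
by rewrite [p]surjective_pairing [q]surjective_pairing p2 q2 px qx.
Qed.

Lemma arc_interior_spans e p : arc_interior D (val e) p ->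
  spans d e p.1 /\ p.2 = height d e p.1.
Proof.
move=> [ep notend]; have /(rep_arcE rep)[/andP[lp pr] p2] := ep; split=> //.
apply/andP; split; rewrite lt_neqAle ?lp ?pr andbT; apply/eqP => xE;
  apply: notend.
  exists (lend d e); first by rewrite /= (rep_ends rep) set21.
  by apply/esym/(rep_on_end rep nc ep); rewrite // (rep_ends rep) set21.
exists (rend d e); first by rewrite /= (rep_ends rep) set22.
by apply/esym/(rep_on_end rep nc ep); rewrite // (rep_ends rep) set22.
Qed.

Lemma arc_interior_disjoint e f p : e != f ->
  arc_interior D (val e) p -> arc_interior D (val f) p -> False.
Proof.
move=> ef /arc_interior_spans[et ep] /arc_interior_spans[ft fp].
by have := height_neq nc ef et (spans_covers ft); rewrite -ep -fp eqxx.
Qed.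

Lemma represents_disjoint (f g : {set G}) p : f \in edges G -> g \in edges G ->
  f != g -> arc_interior D f p -> arc_interior D g p -> False.
Proof.
move=> fE gE fg.
exact: (@arc_interior_disjoint (exist _ f fE) (exist _ g gE)).
Qed.

Lemma represents_off (f : {set G}) v : f \in edges G -> v \notin f ->
  ~ arc D f (pos D v).
Proof.
move=> fE; pose e : edge G := exist _ f fE; rewrite -[f]/(val e) => vf.
rewrite (rep_pos rep) => /(rep_arcE rep) /= [ev vh].
have [sp|end_v] := boolP (spans d e (absc d v)).
  by have := height_off nc sp; rewrite -vh eqxx.
move: vf; rewrite (rep_ends rep).
by case: (covers_spans nc ev end_v) => <-; rewrite !inE eqxx ?orbT.
Qed.

(** In a layout represented by a noncrossing diagram distinct edges have
disjoint interiors, so the conditions on crossings hold vacuously. *)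
Lemma represents_drawing :
  (forall u v, [set u; v]%SET \in edges G ->
     jordan_arc (arc D [set u; v]%SET) (pos D u) (pos D v)) ->
  is_drawing D /\ noncrossing D.
Proof.
move=> hjordan.
have disj (f g : {set G}) p : f \in edges G -> g \in edges G -> f != g ->
    ~ cross_at D f g p.
  by move=> fE gE fg [fp gp _]; apply: (represents_disjoint fE gE fg fp gp).
split; last by move=> f g fE gE fg p; apply: disj.
split=> //.
- exact: represents_off.
- move=> f g fE gE fg; rewrite (_ : [set _ | _] = set0) //.
  by apply/seteqP; split=> // p pc; case: (disj _ _ _ fE gE fg pc).
- by move=> f g h p fE gE hE fg gh fh [pc _ _]; case: (disj _ _ _ fE gE fg pc).
- by move=> f g p fE gE fg fp gp; case: (represents_disjoint fE gE fg fp gp).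
- by move=> u v; rewrite /= !(rep_pos rep) /= => /(absc_inj nc).
Qed.

End Realized.

Lemma edge_endpoints d e u v : lend d e != rend d e ->
  val e = [set lend d e; rend d e]%SET -> val e = [set u; v]%SET ->
  u = lend d e /\ v = rend d e \/ u = rend d e /\ v = lend d e.
Proof.
move=> lr ends uvE.
move: (set21 (lend d e) (rend d e)) (set22 (lend d e) (rend d e)).
rewrite -ends uvE => /set2P[] lE /set2P[] rE; rewrite lE rE.
- by move: lr; rewrite lE rE eqxx.
- by left.
- by right.
- by move: lr; rewrite lE rE eqxx.
Qed.

(** At a vertex [v], which edges leave to the left or to the right depends only
on which of their ends is [v], and their order only on [lower]. *)
Lemma equivalent_diagrams (D D' : layout R G) d d' :
  represents D d -> represents D' d' ->
  noncrossing_diagram d -> noncrossing_diagram d' ->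
  lend d' = lend d -> rend d' = rend d -> 
  (forall e f, lower d' e f = lower d e f) -> equivalent D D'.
Proof.
move=> rep rep' nc nc' lE rE lowE; split.
- exact: represents_x_monotone rep.
- exact: represents_x_monotone rep'.
have abv v e f : common_end d v e f ->
    lies_above D v (val e) (val f) <-> lies_above D' v (val e) (val f).
  move=> cm; have cm' : common_end d' v e f by rewrite /common_end lE rE.
  by rewrite (lies_aboveP rep nc cm) (lies_aboveP rep' nc' cm') lowE.
move=> v; split.
- move=> f fE; rewrite -[f]/(val (exist _ f fE : edge G)) => vf.
  by rewrite !(leaves_leftP rep nc vf, leaves_leftP rep' nc' vf,
    leaves_rightP rep nc vf, leaves_rightP rep' nc' vf) lE rE.
- move=> f g fE gE.
  pose e : edge G := exist _ f fE; pose e' : edge G := exist _ g gE.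
  rewrite -[f]/(val e) -[g]/(val e') => vf vg.
  move=> /(leaves_leftP rep nc vf) ve /(leaves_leftP rep nc vg) ve'.
  by apply: abv; right.
- move=> f g fE gE.
  pose e : edge G := exist _ f fE; pose e' : edge G := exist _ g gE.
  rewrite -[f]/(val e) -[g]/(val e') => vf vg.
  move=> /(leaves_rightP rep nc vf) ve /(leaves_rightP rep nc vg) ve'.
  by apply: abv; left.
Qed.

End StraightLayout.

Theorem theorem2 (R : realType) (G : sgraph) (D : layout R G)
  (hD : is_drawing D) (hmono : x_monotone D) (hnc : noncrossing D) :
  exists D' : layout R G,
    [/\ is_drawing D', noncrossing D', straight_line D', equivalent D D'
      & forall v : G, (pos D' v).1 = (pos D v).1].
Proof.
have [d [rep lr]] := drawing_represented hD hmono.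
have nc := drawing_diagram hD hnc rep lr.
have [z [nc' lowE]] := straighten_diagram nc.
have rep' := straight_layout_represented z nc (rep_ends rep).
set D' := straight_layout (chord_diagram d z) in rep'.
have endsP u v : [set u; v]%SET \in edges G ->
    (pos D' u).1 != (pos D' v).1 /\
    arc D' [set u; v]%SET = segment (pos D' u) (pos D' v).
  move=> uvE; pose e : edge G := Sub [set u; v]%SET uvE.
  have lre : lend d e != rend d e.
    by apply: contraTneq (lr e) => ->; rewrite ltxx.
  have arcE := straight_layout_arc (chord_diagram d z) e.
  rewrite -[[set u; v]%SET]/(val e) arcE /=.
  have uvV : val e = [set u; v]%SET by [].
  have [[-> ->]|[-> ->]] := edge_endpoints lre (rep_ends rep e) uvV.
    by rewrite lt_eqF ?lr.
  by rewrite segment_sym gt_eqF ?lr.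
have [dr ncD'] : is_drawing D' /\ noncrossing D'.
  apply: (represents_drawing rep' nc') => u v /endsP[uv ->].
  exact: segment_jordan.
exists D'; split=> //.
- by move=> u v /endsP[].
- exact: (equivalent_diagrams rep rep' nc nc').
- by move=> v; rewrite (rep_pos rep).
Qed.
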